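(* Consider the linear regression model $y=X\beta+\varepsilon$ with random design $X\in\mathbb R^{n\times p_n}$ (independent of $\varepsilon$), $\varepsilon\sim N(0,I_n)$, $\beta\in\mathcal B(p_n,s_n)$, with $\limsup s_n/p_n=\zeta\in[0,1)$ and $n,p_n\to\infty$. Assume that for any $c_3>0$, $\min_{1\le i\le p_n}P\big(|\|x_i\|^2/n-1|\le c_3\big)\to1$, where $x_i$ is the $i$th column of $X$. Let $c_1>0$ be a constant. Then there is a constant $C>0$ such that, for all sufficiently large $n$: (i) if $\lim s_n/p_n=\zeta>0$, then $$\inf_{\widehat\beta\in\Omega_o^l(c_1)}\ \sup_{\beta\in\mathcal B(p_n,s_n)}E_XE_\beta[\mathrm{FP}(\widehat\beta)]\ \ge\ C\,p_n;$$ (ii) if $\lim s_n/p_n=0$, then for some real sequence $\delta_n\to0$ $$\inf_{\widehat\beta\in\Omega_o^l(c_1)}\ \sup_{\beta\in\mathcal B(p_n,s_n)}E_XE_\beta[\mathrm{FP}(\widehat\beta)]\ \ge\ C\,p_n(s_n/p_n)^{c_1/2+\delta_n}.$$ Moreover, these lower bounds are attained under the exactly orthogonal design (columns of $X$ mutually orthogonal, each of norm $\sqrt n$), provided that $\Omega_o^l(c_1)$ is nonempty and, in case (ii), $\liminf c_1s_n\log(p_n/s_n)/(n\,r^l_{\rm opt})\ge1$: under that design the infimum-supremum above is at most $C'p_n$ in case (i), and at most $C'p_n(s_n/p_n)^{c_1/2+\delta_n'}$ in case (ii), for some constant $C'$ and some real sequence $\delta'_n\to0$, for all sufficiently large $n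$.
   Context: $1\le s_n\le p_n$ are integers. $\mathcal B(p_n,s_n)=\{\beta\in\mathbb R^{p_n}:\|\beta\|_0\le s_n\}$, where $\|\beta\|_0$ is the number of nonzero entries. An estimator is any (measurable) function $\widehat\beta=\widehat\beta(X,y)\in\mathbb R^{p_n}$; it is allowed to depend on $s_n$. $E_\beta$ is expectation over $y$ given $X$ under the true parameter $\beta$; $E_X$ is expectation over the distribution of $X$. $\mathrm{FP}(\widehat\beta)=|\{j:\widehat\beta_j\ne0,\ \beta_j=0\}|$. The class of rate minimax estimators is $$\Omega_o^l(c_1)=\Big\{\widehat\beta:\ \sup_{\beta\in\mathcal B(p_n,s_n)}E_XE_\beta\|\beta-\widehat\beta\|^2\le c_1s_n\log(p_n/s_n)/n\Big\}.$$ $r^l_{\rm opt}=\inf_{\widehat\beta}\sup_{\beta\in\mathcal B(p_n,s_n)}E_XE_\beta\|\widehat\beta-\beta\|^2$ (infimum over all estimators). The infimum over an empty set is $+\infty$. *)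

(* Defs.v *)
From HB Require Import structures.
From mathcomp Require Import all_boot all_order all_algebra.
From mathcomp Require Import all_classical all_reals all_analysis.

Set Implicit Arguments.
Unset Strict Implicit.
Unset Printing Implicit Defensive.

Import Order.TTheory GRing.Theory Num.Theory.
Import numFieldNormedType.Exports.

Local Open Scope classical_set_scope.
Local Open Scope ring_scope.

Definition measure_matrix_display : measure_display -> measure_display.
Proof. exact. Qed.

(* Product sigma-algebra on matrices, generated by the entries. *)
Section measurable_matrix.
Context {d : measure_display} {T : measurableType d}.
Variables m n : nat.

Definition matrix_gen : set (set 'M[T]_(m, n)) :=
  [set A | exists i j, exists2 B : set T, measurable B &
     A = [set M : 'M[T]_(m, n) | B (M i j)]].

Let matrix_set0 : <<s matrix_gen >> set0.
Proof. exact: sigma_algebra0. Qed.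

Let matrix_setC A : <<s matrix_gen >> A -> <<s matrix_gen >> (~` A).
Proof. exact: sigma_algebraC. Qed.

Let matrix_bigcup (F : (set 'M[T]_(m, n))^nat) :
  (forall i, <<s matrix_gen >> (F i)) -> <<s matrix_gen >> (\bigcup_i F i).
Proof. exact: sigma_algebra_bigcup. Qed.

HB.instance Definition _ := @isMeasurable.Build (measure_matrix_display d)
  'M[T]_(m, n) <<s matrix_gen >> matrix_set0 matrix_setC matrix_bigcup.

Lemma measurable_entry (i : 'I_m) (j : 'I_n) :
  measurable_fun setT (fun M : 'M[T]_(m, n) => M i j).
Proof.
by move=> _ B mB; rewrite setTI; apply: sub_sigma_algebra; exists i, j, B.
Qed.

Lemma measurable_fun_entryP d' (T' : measurableType d') (f : T' -> 'M[T]_(m, n)) :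
  measurable_fun setT f <-> forall i j, measurable_fun setT (fun x => f x i j).
Proof.
split=> [mf i j|mf].
  exact: (measurableT_comp (measurable_entry i j) mf).
have : @measurable _ 'M[T]_(m, n) `<=` [set A | measurable (f @^-1` A)].
  apply: smallest_sub; last first.
    by move=> _ [i [j [B mB ->]]]; rewrite /= -[X in measurable X]setTI; exact: mf.
  split=> /=; first by rewrite preimage_set0.
    by move=> A mA; rewrite setTD preimage_setC; exact: measurableC.
  by move=> F mF; rewrite preimage_bigcup; exact: bigcupT_measurable.
by move=> fS _ A mA; rewrite setTI; exact: fS.
Qed.

End measurable_matrix.

Section std_gauss.
Context {R : realType}.

(* [normal_prob] lives on [measurableTypeR R], which carries the same
   sigma-algebra as [R] under another display. *)
Definition vcons n (xv : measurableTypeR R * 'cV[R]_n) : 'cV[R]_n.+1 :=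
  col_mx ((xv.1 : R)%:M : 'cV[R]_1) xv.2.

Lemma measurable_vcons n : measurable_fun setT (@vcons n).
Proof.
apply/measurable_fun_entryP => i j; rewrite /vcons.
rewrite -[i](splitK (m := 1%N)); case: (fintype.split _) => k /=.
  apply: (eq_measurable_fun (fst : measurableTypeR R * 'cV[R]_n -> R)) => [x _|].
    by rewrite (@col_mxEu _ 1%N) mxE !ord1 eqxx mulr1n.
  by move=> _ B mB; exact: (@measurable_fst _ _ (measurableTypeR R)).
apply: (eq_measurable_fun
  (fun x : measurableTypeR R * 'cV[R]_n => x.2 k j)) => [x _|].
  by rewrite (@col_mxEd _ 1%N).
exact: (measurableT_comp (measurable_entry k j) measurable_snd).
Qed.

HB.instance Definition _ n :=
  isMeasurableFun.Build _ _ _ _ (@vcons n) (@measurable_vcons n).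

Definition std_normal : probability (measurableTypeR R) R := normal_prob 0 1.

(* The law N(0, I_n), as the n-fold product of N(0, 1). *)
Fixpoint std_gauss n : probability 'cV[R]_n R :=
  if n is m.+1 then distribution (std_normal \x std_gauss m)%E (@vcons m)
  else \d_(0 : 'cV[R]_0).

Lemma std_gauss_box n (A : 'I_n -> set R) : (forall i, measurable (A i)) ->
  std_gauss n [set v | forall i, A i (v i 0)] =
  (\prod_(i < n) normal_prob 0 1 (A i))%E.
Proof.
elim: n A => [|n IHn] A mA.
  rewrite big_ord0 /= diracE mem_set//= => -[]//.
rewrite big_ord_recl /= /distribution /pushforward /=.
have -> : @vcons n @^-1` [set v | forall i, A i (v i 0)] =
    A ord0 `*` [set v : 'cV[R]_n | forall i : 'I_n, A (lift ord0 i) (v i 0)].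
  have vcE (x : measurableTypeR R * 'cV[R]_n) :
      (vcons x ord0 0 = x.1) * (forall i, vcons x (lift ord0 i) 0 = x.2 i 0).
    split=> [|i].
      rewrite (_ : ord0 = lshift n (ord0 : 'I_1)); last exact: val_inj.
      by rewrite /vcons (@col_mxEu _ 1%N) mxE eqxx mulr1n.
    rewrite (_ : lift ord0 i = rshift 1 i); last exact: val_inj.
    by rewrite /vcons (@col_mxEd _ 1%N).
  apply/seteqP; split=> [x /= Ax|x /= [A0 AS] i].
    by split=> [|i]; [have := Ax ord0|have := Ax (lift ord0 i)]; rewrite vcE.
  by case: (unliftP ord0 i) => [j|] ->; rewrite vcE.
rewrite -IHn//; apply: product_measure1E; first exact: mA.
rewrite (_ : [set v | _] =
    \bigcap_(i in [set: 'I_n]) [set v : 'cV[R]_n | A (lift ord0 i) (v i 0)]).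
  apply: fin_bigcap_measurable => // i _.
  by rewrite -[X in measurable X]setTI; apply: measurable_entry => //.
by apply/seteqP; split=> [v /= Av i _|v /= Av i]; exact: Av.
Qed.

End std_gauss.
Arguments std_gauss R n : clear implicits.

Section linear_model.
Context {R : realType}.

(* Euclidean norm; the library norm of a matrix is the max norm. *)
Definition enorm m (v : 'cV[R]_m) : R := Num.sqrt (\sum_(i < m) v i 0 ^+ 2).

Definition l0norm p (beta : 'cV[R]_p) : nat := #|[set i | beta i 0 != 0]%SET|.

Definition sparse p s : set 'cV[R]_p := [set beta | (l0norm beta <= s)%N].

Definition FP p (betahat beta : 'cV[R]_p) : nat :=
  #|[set j | (betahat j 0 != 0) && (beta j 0 == 0)]%SET|.

Definition estimator n p :=
  {mfun ('M[R]_(n, p) * 'cV[R]_n)%type >-> 'cV[R]_p}.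

(* E_X E_beta f(X, y) for y = X beta + eps, where mu is the law of X; eps is
   integrated against N(0, I_n) whatever the value of X, since it is
   independent of X. *)
Definition EXEbeta n p (mu : probability 'M[R]_(n, p) R) (beta : 'cV[R]_p)
    (f : 'M[R]_(n, p) * 'cV[R]_n -> R) : \bar R :=
  (\int[mu]_X \int[std_gauss R n]_eps (f (X, X *m beta + eps)%R)%:E)%E.

Definition sup_risk n p s (mu : probability 'M[R]_(n, p) R)
    (bh : estimator n p) : \bar R :=
  ereal_sup [set EXEbeta mu beta (fun z => enorm (beta - bh z) ^+ 2)
            | beta in sparse s].

Definition sup_FP n p s (mu : probability 'M[R]_(n, p) R)
    (bh : estimator n p) : \bar R :=
  ereal_sup [set EXEbeta mu beta (fun z => (FP (bh z) beta)%:R)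
            | beta in sparse s].

Definition Omega n p s (mu : probability 'M[R]_(n, p) R) (c1 : R) :
    set (estimator n p) :=
  [set bh | (sup_risk s mu bh
             <= (c1 * s%:R * ln (p%:R / s%:R) / n%:R)%:E)%E].

Definition r_opt n p s (mu : probability 'M[R]_(n, p) R) : \bar R :=
  ereal_inf [set sup_risk s mu bh | bh in [set: estimator n p]].

Definition minimax_FP n p s (mu : probability 'M[R]_(n, p) R) (c1 : R) :
    \bar R :=
  ereal_inf [set sup_FP s mu bh | bh in Omega s mu c1].

Definition orthogonal_design n p (X : 'M[R]_(n, p)) : Prop :=
  (forall i j, i != j -> (col i X)^T *m col j X = 0) /\
  (forall i, enorm (col i X) = Num.sqrt n%:R).

End linear_model.

(* Main.v *)
Require Import Defs.
From HB Require Import structures.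
From mathcomp Require Import all_boot all_order all_algebra.
From mathcomp Require Import all_classical all_reals all_analysis.
From mathcomp Require Import measurable_realfun ring lra zify.

Set Implicit Arguments.
Unset Strict Implicit.
Unset Printing Implicit Defensive.

Import Order.TTheory GRing.Theory Num.Theory.
Import numFieldNormedType.Exports.

Local Open Scope classical_set_scope.
Local Open Scope ring_scope.

(**
Write L = log(p/s). Everything rests on the Cameron-Martin formula for N(0, I_n).

Lower bounds. Put signals of size a with a^2 = t L / n, t slightly above c1, on
a random support S of size s. A risk at most c1 s L / n forces the estimator to
exceed kappa a on a fixed proportion of S. Removing one index j from S changes
the law of y by a factor which, up to a small probability, is at least
exp(- a^2 |x_j|^2 (1/2 + theta)), about (s/p)^(c1/2); so the estimator also
exceeds kappa a at j when beta_j = 0, with about that probability. Averaging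
over S bounds from below the number of false positives, and also the risk:
when c1 < 2 the latter bound shows that Omega is eventually empty.

Upper bound. When c1 >= 2 and the design is orthogonal, hard thresholding of
X^T y / n at (sqrt(c1 L) + 1) / sqrt n belongs to Omega and has at most
2 p (s/p)^(c1/2) expected false positives.
*)

(** * The Cameron-Martin formula *)

(** Neither bound has slack in the constant c1. A missed signal costs (1 - kappa)^2 a^2, so a
    positive proportion of detections is forced only if (1 - kappa)^2 t > c1. The exponent then
    exceeds c1/2 by an amount governed by t, by theta and by the tolerance on the column norms;
    these are fixed for each eps, and a diagonal choice produces delta_n. Detection means |bh_j| >=
    kappa a, not merely bh_j <> 0, because a false detection of that size also costs (kappa a)^2 in
    squared error. Against the risk budget this gives p (s/p)^(c1/2 + eps) = O(s), impossible for c1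
    < 2 and small eps.

    For the upper bound, membership in Omega asks for c1 s L / n exactly, while the threshold lies
    above sqrt(c1 L). A bound lam^2 + O(lam) on the cost of a signal would be too weak: the cost has
    to fall below lam^2 by a linear term, which requires a separate study of signals close to the
    threshold. *)

Lemma integral_cst_prob {d : measure_display} {T : measurableType d}
    {R : realType} (P : probability T R) (c : R) :
  (\int[P]_x c%:E = c%:E)%E.
Proof. by rewrite integral_cst//= probability_setT mule1. Qed.

(** * Integration against a measure with a density *)

Section density.
Local Open Scope ereal_scope.
Context {d : measure_display} {T : measurableType d} {R : realType}.
Variables (mu nu : {measure set T -> \bar R}) (g : T -> R).
Hypothesis mg : measurable_fun setT g.
Hypothesis g0 : forall x, (0 <= g x)%R.
Hypothesis nuE : forall A, measurable A -> nu A = \int[mu]_(x in A) (g x)%:E.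

Import HBNNSimple.

(** [nuE] is the case of indicators; linearity extends it to simple functions and monotone
    convergence to nonnegative ones. *)
Lemma ge0_integral_density (f : T -> \bar R) :
  measurable_fun setT f -> (forall x, 0 <= f x) ->
  \int[nu]_x f x = \int[mu]_x (f x * (g x)%:E).
Proof.
move=> mf f0; pose f_ := nnsfun_approx measurableT mf.
have mfg n : measurable_fun setT (fun x => (f_ n x * g x)%:E).
  by apply/measurable_EFinP/measurable_funM.
transitivity (limn (fun n => \int[nu]_x (f_ n x)%:E)).
  rewrite -monotone_convergence//.
  - by apply: eq_integral => x _; apply/esym/cvg_lim => //; exact: cvg_nnsfun_approx.
  - by move=> n; exact/measurable_EFinP.
  - by move=> n y _; rewrite lee_fin.
  - by move=> y _ m n mn; rewrite lee_fin; exact/lefP/nd_nnsfun_approx.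
transitivity (limn (fun n => \int[mu]_x (f_ n x * g x)%:E)); last first.
  rewrite -monotone_convergence//.
  - apply: eq_integral => x _; apply/cvg_lim => //.
    under eq_fun do rewrite EFinM.
    by apply: cvgeZr => //; exact: cvg_nnsfun_approx.
  - by move=> n y _; rewrite lee_fin mulr_ge0.
  - move=> y _ m n mn; rewrite lee_fin ler_wpM2r//.
    exact/lefP/nd_nnsfun_approx.
congr (limn _); apply/funext => n.
have mA r : measurable (f_ n @^-1` [set r]) by exact: measurable_sfunP.
transitivity (\sum_(k \in range (f_ n))
    \int[mu]_x (k * (\1_(f_ n @^-1` [set k]) x * g x))%:E).
  under eq_integral do rewrite fimfunE -fsumEFin//.
  rewrite ge0_integral_fsum//; last 2 first.
  - by move=> y; exact/measurable_EFinP/measurable_funM.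
  - by move=> y x _; rewrite nnfun_muleindic_ge0.
  apply: eq_fsbigr => r /[!inE] -[x _ fxr].
  have r0 : (0 <= r)%R by rewrite -fxr.
  rewrite integralZl_indic_nnsfun// integral_indic//= setIT nuE//.
  under [RHS]eq_integral do rewrite EFinM.
  rewrite ge0_integralZl_EFin//.
  - congr (_ * _); rewrite integral_mkcond; apply: eq_integral => y _.
    rewrite /= patchE indicE; case: ifPn => _; by rewrite ?mul1r ?mul0r.
  - by move=> y _; rewrite lee_fin mulr_ge0.
  - by apply/measurable_EFinP/measurable_funM.
rewrite -ge0_integral_fsum//.
- apply: eq_integral => x _; rewrite fimfunE mulr_fsuml// fsumEFin//.
  by congr (_%:E); apply: eq_fsbigr => k _; rewrite mulrA.
- by move=> r; apply/measurable_EFinP/measurable_funM => //; exact: measurable_funM.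
- move=> r x _; rewrite lee_fin mulrA mulr_ge0//.
  by have := nnfun_muleindic_ge0 (f_ n) r x; rewrite -EFinM lee_fin.
Qed.

End density.

(** * Translation of the one-dimensional normal law *)

Section normal_shift.
Context {R : realType}.
Local Notation leb := (@lebesgue_measure R).

(** The translated measure agrees with Lebesgue measure on half-open intervals, which determine
    it. *)
Lemma lebesgue_measure_shift (h : R) (A : set R) : measurable A ->
  pushforward leb (fun x : measurableTypeR R => x + h : measurableTypeR R) A = leb A.
Proof.
move=> mA; apply/esym.
have mh : measurable_fun setT (fun x : measurableTypeR R => x + h : measurableTypeR R).
  exact: measurable_funD.
pose sh : {mfun measurableTypeR R >-> measurableTypeR R} :=
  HB.pack (fun x : measurableTypeR R => x + h : measurableTypeR R)
    (isMeasurableFun.Build _ _ _ _ _ mh).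
suff H : forall X, ocitv X -> leb X = pushforward leb sh X.
  exact: (@lebesgue_measure_unique _ (pushforward leb sh) H A mA).
move=> _ [[a b]] _ <-.
rewrite /pushforward/=.
have -> : (fun x => x + h) @^-1` `]a, b] = `]a - h, b - h]%classic.
  by apply/seteqP; split => x /=; rewrite !in_itv/= ltrBlDr lerBrDr.
rewrite !lebesgue_measure_itv/= !lte_fin ltrD2r.
by case: ifP => // _; rewrite -!EFinB; congr (_%:E); ring.
Qed.

Local Open Scope ereal_scope.

Lemma ge0_integral_shift (h : R) (f : R -> \bar R) :
  measurable_fun setT f -> (forall x, 0 <= f x) ->
  \int[leb]_x f (x + h)%R = \int[leb]_x f x.
Proof.
move=> mf f0.
transitivity (\int[pushforward leb (fun x : measurableTypeR R => (x + h)%R : measurableTypeR R)]_x f x).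
  rewrite ge0_integral_pushforward//=.
  exact: measurable_funD.
apply: eq_measure_integral => [|mh A mA _]; first exact: measurable_funD.
exact: lebesgue_measure_shift.
Qed.

(** The density phi of N(0, 1) satisfies phi(x - h) = phi(x) exp(h x - h^2 / 2); the rest is
    translation invariance of Lebesgue measure. *)
Lemma normal_prob_shift (h : R) (f : measurableTypeR R -> \bar R) :
  measurable_fun setT f -> (forall x, 0 <= f x) ->
  \int[@std_normal R]_x f (x + h)%R =
  \int[@std_normal R]_x (f x * (expR (h * (x : R) - h ^+ 2 / 2))%:E).
Proof.
move=> mf f0.
(* [measurableTypeR R] and [R] share their sigma-algebra under different displays, so measurability
   is carried across by unfolding it. *)
have mfR : measurable_fun (T := R) setT f by move=> _ B mB; exact: mf.
have mpdf : measurable_fun setT (normal_pdf 0 1 : measurableTypeR R -> R).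
  by move=> _ B mB; exact: measurable_normal_pdf.
have pdf0 (x : measurableTypeR R) : (0 <= normal_pdf 0 1 (x : R) :> R)%R.
  exact: normal_pdf_ge0.
have npE (A : set (measurableTypeR R)) : measurable A ->
   @std_normal R A = \int[leb]_(x in A) (normal_pdf 0 1 x)%:E by [].
have mexp : measurable_fun (T := R) setT
    (fun x : R => (expR (h * x - h ^+ 2 / 2))%:E).
  apply/measurable_EFinP; apply: measurableT_comp => //.
  by apply: measurable_funB => //; exact: measurable_funM.
rewrite !(ge0_integral_density mpdf pdf0 npE)//; last 3 first.
- apply: emeasurable_funM; first exact: mf.
  by move=> _ B mB; exact: mexp.
- by move=> x; rewrite mule_ge0// lee_fin expR_ge0.
- have mh : measurable_fun setT (fun x : measurableTypeR R => (x + h)%R : measurableTypeR R).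
    exact: measurable_funD.
  exact: (measurableT_comp mf mh).
pose F (x : R) := f x * (normal_pdf 0 1 (x - h))%:E.
transitivity (\int[leb]_x F (x + h)%R).
  by apply: eq_integral => x _; rewrite /F addrK.
rewrite ge0_integral_shift//; last 2 first.
- apply: emeasurable_funM; first exact: mfR.
  apply/measurable_EFinP; apply: measurableT_comp; first exact: measurable_normal_pdf.
  exact: measurable_funB.
- by move=> x; rewrite mule_ge0// lee_fin normal_pdf_ge0.
apply: eq_integral => x _; rewrite /F -muleA -EFinM; congr (_ * _%:E).
rewrite /normal_pdf oner_eq0 /normal_fun mulrCA -expRD.
by congr (_ * expR _)%R; field.
Qed.

End normal_shift.

(** * Translation and Laplace transform of N(0, I_n) *)

Section gauss.
Context {R : realType}.

Definition dotp n (u v : 'cV[R]_n) : R := \sum_(i < n) u i 0 * v i 0.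

Lemma measurable_dotp n (u : 'cV[R]_n) : measurable_fun setT (dotp u).
Proof.
rewrite /dotp; apply: measurable_sum => i.
by apply: measurable_funM => //; exact: measurable_entry.
Qed.

Lemma measurable_expR_dotp n (u : 'cV[R]_n) (c : R) :
  measurable_fun setT (fun e => (expR (dotp u e - c))%:E).
Proof.
apply/measurable_EFinP; apply: measurableT_comp => //.
by apply: measurable_funB => //; exact: measurable_dotp.
Qed.

Lemma measurable_addv n (h : 'cV[R]_n) : measurable_fun setT (fun e : 'cV[R]_n => e + h).
Proof.
apply/measurable_fun_entryP => i j.
apply: (eq_measurable_fun (fun e : 'cV[R]_n => e i j + h i j)) => [e _|].
  by rewrite mxE.
by apply: measurable_funD => //; exact: measurable_entry.
Qed.

Lemma vconsE n (x : R) (v : 'cV[R]_n) :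
  (vcons (x, v) ord0 0 = x) * (forall i, vcons (x, v) (lift ord0 i) 0 = v i 0).
Proof.
split=> [|i].
  rewrite (_ : ord0 = lshift n (ord0 : 'I_1)); last exact: val_inj.
  by rewrite /vcons (@col_mxEu _ 1%N) mxE eqxx mulr1n.
rewrite (_ : lift ord0 i = rshift 1 i); last exact: val_inj.
by rewrite /vcons (@col_mxEd _ 1%N).
Qed.

Local Open Scope ereal_scope.

Lemma ge0_integral_std_gaussS n (f : 'cV[R]_n.+1 -> \bar R) :
  measurable_fun setT f -> (forall x, 0 <= f x) ->
  \int[std_gauss R n.+1]_e f e =
  \int[std_normal]_x \int[std_gauss R n]_v f (vcons (x, v)).
Proof.
move=> mf f0; rewrite /= ge0_integral_pushforward//= preimage_setT.
rewrite fubini_tonelli1//.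
by apply: measurableT_comp => //; exact: measurable_vcons.
Qed.

(** Induction on the dimension: the exponential factor splits into the first coordinate and the
    rest. The induction hypothesis shifts the inner integral, [normal_prob_shift] the outer one. *)
Lemma std_gauss_shift n (h : 'cV[R]_n) (f : 'cV[R]_n -> \bar R) :
  measurable_fun setT f -> (forall x, 0 <= f x) ->
  \int[std_gauss R n]_e f (e + h)%R =
  \int[std_gauss R n]_e (f e * (expR (dotp h e - dotp h h / 2))%:E).
Proof.
elim: n h f => [|n IHn] h f mf f0.
  rewrite /= !integral_dirac//=.
  - rewrite diracT !mul1e /dotp !big_ord0 mul0r subr0 expR0 mule1.
    by congr f; apply/matrixP => -[].
  - by apply: emeasurable_funM => //; exact: measurable_expR_dotp.
  - by apply: measurableT_comp => //; exact: measurable_addv.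
pose h' : 'cV[R]_n := \col_i h (lift ord0 i) 0%R.
pose h0 := h ord0 0%R.
have addE (x : R) v : (vcons (x, v) + h)%R = vcons ((x + h0)%R, (v + h')%R).
  apply/matrixP => i j; rewrite !ord1.
  by case: (unliftP ord0 i) => [k|] ->; rewrite mxE !vconsE ?mxE.
have dotE (x : R) v : dotp h (vcons (x, v)) = (h0 * x + dotp h' v)%R.
  rewrite /dotp big_ord_recl vconsE; congr (_ + _)%R.
  by apply: eq_bigr => i _; rewrite vconsE mxE.
have normE : dotp h h = (h0 ^+ 2 + dotp h' h')%R.
  rewrite /dotp big_ord_recl expr2; congr (_ + _)%R.
  by apply: eq_bigr => i _; rewrite mxE.
rewrite !ge0_integral_std_gaussS//; last 3 first.
- by apply: emeasurable_funM => //; exact: measurable_expR_dotp.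
- by move=> x; rewrite mule_ge0// lee_fin expR_ge0.
- by apply: measurableT_comp => //; exact: measurable_addv.
pose G (z : measurableTypeR R * 'cV[R]_n) :=
  f (vcons z) * (expR (dotp h' z.2 - dotp h' h' / 2))%:E.
have mG : measurable_fun setT G.
  apply: emeasurable_funM.
    by apply: measurableT_comp => //; exact: measurable_vcons.
  exact: (measurableT_comp (measurable_expR_dotp h' _) measurable_snd).
have G0 z : 0 <= G z by rewrite mule_ge0// lee_fin expR_ge0.
pose F (x : measurableTypeR R) := \int[std_gauss R n]_v G (x, v).
transitivity (\int[std_normal]_x F (x + h0)%R).
  apply: eq_integral => x _; rewrite /F /G/= -IHn//.
    by apply: eq_integral => v _; rewrite addE.
  apply: measurableT_comp => //.
  exact: (measurableT_comp (@measurable_vcons R n) (pair1_measurable _)).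
rewrite normal_prob_shift; last 2 first.
- exact: measurable_fun_fubini_tonelli_F.
- by move=> x; exact: integral_ge0.
apply: eq_integral => x _; rewrite /F -ge0_integralZr//; last first.
  exact: (measurableT_comp mG (pair1_measurable _)).
apply: eq_integral => v _; rewrite /G/= -muleA -EFinM -expRD dotE normE.
by congr (_ * (expR _)%:E); field.
Qed.

(** The shift formula applied to the constant 1: the density of the translated law has total mass
    1. *)
Lemma std_gauss_mgf n (h : 'cV[R]_n) :
  \int[std_gauss R n]_e (expR (dotp h e))%:E = (expR (dotp h h / 2))%:E.
Proof.
have := @std_gauss_shift n h (cst 1%:E) (measurable_cst _) (fun=> lee01).
rewrite (integral_cst_prob _ 1) => /esym.
under eq_integral do rewrite /cst mul1e expRD EFinM.
rewrite ge0_integralZr//; last first.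
  by apply/measurable_EFinP; apply: measurableT_comp => //; exact: measurable_dotp.
move=> /(congr1 (fun x => x * (expR (dotp h h / 2))%:E)).
by rewrite -muleA -EFinM -expRD addNr expR0 mule1 mul1e.
Qed.

End gauss.

Section dotp_theory.
Context {R : realType}.

Lemma dotpZl n (c : R) (u v : 'cV[R]_n) : dotp (c *: u) v = c * dotp u v.
Proof. by rewrite /dotp mulr_sumr; apply: eq_bigr => i _; rewrite mxE mulrA. Qed.

Lemma dotpC n (u v : 'cV[R]_n) : dotp u v = dotp v u.
Proof. by apply: eq_bigr => i _; rewrite mulrC. Qed.

Lemma dotpZr n (c : R) (u v : 'cV[R]_n) : dotp u (c *: v) = c * dotp u v.
Proof. by rewrite dotpC dotpZl dotpC. Qed.

Lemma dotpNl n (u v : 'cV[R]_n) : dotp (- u) v = - dotp u v.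
Proof. by rewrite -scaleN1r dotpZl mulN1r. Qed.

Lemma dotpNr n (u v : 'cV[R]_n) : dotp u (- v) = - dotp u v.
Proof. by rewrite dotpC dotpNl dotpC. Qed.

Lemma dotpDr n (u v w : 'cV[R]_n) : dotp u (v + w) = dotp u v + dotp u w.
Proof.
by rewrite /dotp -big_split; apply: eq_bigr => i _; rewrite mxE mulrDr.
Qed.

End dotp_theory.

Lemma measurable_natr_bool {d : measure_display} {T : measurableType d}
    {R : realType} (b : T -> bool) :
  measurable_fun setT b -> measurable_fun setT (fun x => (b x)%:R : R).
Proof.
move=> mb; apply: (eq_measurable_fun (fun x => if b x then 1 else 0 : R)).
  by move=> x _; case: (b x).
exact: measurable_fun_ifT.
Qed.

Lemma expRN_le {R : realType} (x : R) : 0 <= x -> expR (- x) <= (1 + x)^-1.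
Proof.
by move=> x0; rewrite expRN lef_pV2 ?posrE ?expR_gt0 ?expR_ge1Dx//; lra.
Qed.

(** * Exponential bounds for Gaussian linear forms *)

Section gauss_tails.
Context {R : realType}.
Local Open Scope ereal_scope.

Lemma measurable_EFin_expR_dotp n (u : 'cV[R]_n) :
  measurable_fun setT (fun e => (expR (dotp u e))%:E).
Proof.
by apply/measurable_EFinP; apply: measurableT_comp => //; exact: measurable_dotp.
Qed.

(* Outside {<h, e> <= theta V} the trivial bound g <= 1 is paid for by the
   exponential Markov inequality. *)
Lemma std_gauss_change_of_measure n (h : 'cV[R]_n) (V theta : R)
    (g : 'cV[R]_n -> R) :
  (dotp h h <= V)%R -> (0 <= theta)%R ->
  measurable_fun setT g -> (forall e, 0 <= g e <= 1)%R ->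
  (expR (- (V * (1 / 2 + theta))))%:E * \int[std_gauss R n]_e (g e)%:E <=
  \int[std_gauss R n]_e (g (e - h)%R)%:E +
  (expR (- (V * (1 / 2 + theta))) * expR (- (theta ^+ 2 * V / 2)))%:E.
Proof.
move=> hV t0 mg g01; set k := expR (- (V * (1 / 2 + theta))).
have k0 : (0 <= k)%R by exact: expR_ge0.
have g0 e : (0 <= g e)%R by case/andP: (g01 e).
have mgE : measurable_fun setT (EFin \o g) by exact/measurable_EFinP.
rewrite (std_gauss_shift (- h) mgE); last by move=> e; rewrite lee_fin.
(* Where <h, e> > theta V the factor exp(theta (<h, e> - theta V)) is at least 1; its integral is at
   most exp(- theta^2 V / 2) because |h|^2 <= V. *)
have tail : \int[std_gauss R n]_e
      ((k * expR (- (theta ^+ 2 * V)))%:E * (expR (dotp (theta *: h) e))%:E) <=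
    (k * expR (- (theta ^+ 2 * V / 2)))%:E.
  rewrite ge0_integralZl_EFin//; last 2 first.
  - exact: measurable_EFin_expR_dotp.
  - by rewrite mulr_ge0 ?expR_ge0.
  rewrite std_gauss_mgf -EFinM lee_fin -[leLHS]mulrA ler_wpM2l// -expRD ler_expR.
  rewrite dotpZl dotpZr; have := sqr_ge0 theta; nra.
apply: le_trans (leeD2l _ tail).
rewrite -ge0_integralD//; last 4 first.
- by move=> e _; rewrite mule_ge0// lee_fin.
- by apply: emeasurable_funM => //; exact: measurable_expR_dotp.
- by move=> e _; rewrite mule_ge0// lee_fin ?mulr_ge0 ?expR_ge0.
- by apply: emeasurable_funM => //; exact: measurable_EFin_expR_dotp.
rewrite -ge0_integralZl_EFin//; last by move=> e _; rewrite lee_fin.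
apply: ge0_le_integral => //.
- by move=> e _; rewrite mule_ge0// lee_fin.
- by apply: emeasurable_funM.
- apply: emeasurable_funD; apply: emeasurable_funM => //.
    exact: measurable_expR_dotp.
  exact: measurable_EFin_expR_dotp.
move=> e _; rewrite /= -!EFinM -EFinD lee_fin -mulrA -expRD dotpNl dotpNl dotpNr.
rewrite opprK dotpZl; set w := dotp h e.
have [wle|wgt] := lerP w (theta * V).
  rewrite -[leLHS]addr0 lerD//; last by rewrite mulr_ge0 ?expR_ge0.
  rewrite [leLHS]mulrC ler_wpM2l// ler_expR; lra.
apply: (@le_trans _ _ k).
  by rewrite -[leRHS]mulr1 ler_wpM2l//; case/andP: (g01 e).
rewrite -[leLHS]add0r lerD//; first by rewrite mulr_ge0 ?expR_ge0.
rewrite -[leLHS]mulr1 ler_wpM2l// -[leLHS]expR0 ler_expR; nra.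
Qed.

Variables (n : nat) (v : 'cV[R]_n).
Hypothesis v1 : dotp v v = 1%R.

Lemma integral_expR_dotp (c : R) :
  \int[std_gauss R n]_e (expR (c * dotp v e))%:E = (expR (c ^+ 2 / 2))%:E.
Proof.
under eq_integral do rewrite -dotpZl.
by rewrite std_gauss_mgf dotpZl dotpZr v1 mulr1 expr2.
Qed.

(** Second moments and tails all reduce to domination by two opposite exponentials of <v, e>, so
    that [std_gauss_mgf] is the only Gaussian integral to compute. *)
Lemma integral_le_expR_dotp (A c : R) (f : 'cV[R]_n -> R) :
  (0 <= A)%R -> measurable_fun setT f ->
  (forall e, 0 <= f e <=
     A * (expR (c * dotp v e) + expR (- c * dotp v e)))%R ->
  \int[std_gauss R n]_e (f e)%:E <= (2 * A * expR (c ^+ 2 / 2))%:E.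
Proof.
move=> A0 mf fle.
have mE b : measurable_fun setT (fun e => (expR (b * dotp v e))%:E).
  under eq_fun do rewrite -dotpZl.
  exact: measurable_EFin_expR_dotp.
apply: (@le_trans _ _ (\int[std_gauss R n]_e (A%:E *
    ((expR (c * dotp v e))%:E + (expR (- c * dotp v e))%:E)))).
  apply: ge0_le_integral => //.
  - by move=> e _; rewrite lee_fin; case/andP: (fle e).
  - exact/measurable_EFinP.
  - by apply: emeasurable_funM => //; exact: emeasurable_funD.
  - by move=> e _; rewrite -EFinD -EFinM lee_fin; case/andP: (fle e).
rewrite ge0_integralZl_EFin//; last 2 first.
- by move=> e _; rewrite -EFinD lee_fin addr_ge0 ?expR_ge0.
- exact: emeasurable_funD.
rewrite ge0_integralD// !integral_expR_dotp sqrrN -EFinD -EFinM lee_fin.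
by rewrite -mulr2n mulrnAr -mulr_natl mulrA.
Qed.

Lemma sqr_le_expR (w : R) : (w ^+ 2 <= 4 * expR `|w|)%R.
Proof.
have : (1 + `|w| / 2 <= expR (`|w| / 2))%R by exact: expR_ge1Dx.
have : (expR (`|w| / 2) ^+ 2 = expR `|w|)%R.
  by rewrite -expRM_natl; congr expR; field.
rewrite -(real_normK (num_real w)).
have := normr_ge0 w; nra.
Qed.

Lemma expR_norm_le (c w : R) :
  (expR (c * `|w|) <= expR (c * w) + expR (- c * w))%R.
Proof.
have [w0|w0] := ger0P w; first by rewrite lerDl expR_ge0.
by rewrite mulrN -mulNr lerDr expR_ge0.
Qed.

(** The exact value is 1; any absolute constant suffices for the thresholding risk. *)
Lemma integral_sqr_dotp :
  \int[std_gauss R n]_e (dotp v e ^+ 2)%:E <= (8 * expR (1 / 2))%:E.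
Proof.
have := @integral_le_expR_dotp 4 1 (fun e => dotp v e ^+ 2)%R.
rewrite expr1n (_ : 2 * 4 = 8 :> R)%R; last by ring.
apply=> //; first by apply: measurable_funX; exact: measurable_dotp.
move=> e; rewrite sqr_ge0/= (le_trans (sqr_le_expR _))// ler_wpM2l//.
by rewrite -[X in expR X]mul1r; exact: expR_norm_le.
Qed.

Lemma expR_tail (lam w : R) : (0 <= lam)%R -> (lam < `|w|)%R ->
  (1 <= expR (- lam ^+ 2) * (expR (lam * w) + expR (- lam * w)))%R.
Proof.
move=> l0 lw; apply: (@le_trans _ _ (expR (- lam ^+ 2) * expR (lam * `|w|))%R).
  rewrite -expRD -[leLHS]expR0 ler_expR; nra.
by rewrite ler_wpM2l ?expR_ge0// expR_norm_le.
Qed.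

Lemma integral_tail_dotp (lam : R) : (0 <= lam)%R ->
  \int[std_gauss R n]_e ((lam < `|dotp v e|)%R%:R)%:E <= (2 * expR (- lam ^+ 2 / 2))%:E.
Proof.
move=> l0.
have := @integral_le_expR_dotp (expR (- lam ^+ 2)) lam
  (fun e => (lam < `|dotp v e|)%R%:R).
rewrite -mulrA -expRD (_ : - lam ^+ 2 + lam ^+ 2 / 2 = - lam ^+ 2 / 2)%R; last by field.
apply; first exact: expR_ge0.
  apply: measurable_natr_bool; apply: measurable_fun_ltr => //.
  by apply: measurableT_comp => //; exact: measurable_dotp.
move=> e; rewrite ler0n/=; case: ltP => [lw|_]; first exact: expR_tail.
by rewrite mulr_ge0 ?addr_ge0 ?expR_ge0.
Qed.

(** The indicator is at most exp(lam |w| - lam^2) and w^2 <= 4 exp |w|, so the two merge into one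
    exponential of rate lam + 1. Compared with exp(- lam^2 / 2) this loses a factor of order
    exp(lam), which the choice of the threshold will absorb. *)
Lemma integral_sqr_tail_dotp (lam : R) : (0 <= lam)%R ->
  \int[std_gauss R n]_e (if (lam < `|dotp v e|)%R then dotp v e ^+ 2 else 0)%:E <=
  (8 * expR ((lam + 1) ^+ 2 / 2 - lam ^+ 2))%:E.
Proof.
move=> l0.
apply: le_trans (@integral_le_expR_dotp (4 * expR (- lam ^+ 2))%R (lam + 1)%R
  (fun e => if (lam < `|dotp v e|)%R then (dotp v e ^+ 2)%R else 0%R) _ _ _) _.
- by rewrite mulr_ge0 ?expR_ge0.
- apply: measurable_fun_ifT => //.
    by apply: measurable_fun_ltr => //; apply: measurableT_comp => //;
      exact: measurable_dotp.
  by apply: measurable_funX; exact: measurable_dotp.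
- move=> e; set w := dotp v e; case: ifPn => [lw|_]; last first.
  by rewrite lexx !mulr_ge0 ?addr_ge0 ?expR_ge0.
rewrite sqr_ge0 /=.
apply: (@le_trans _ _ (4 * expR (- lam ^+ 2) * expR ((lam + 1) * `|w|))%R).
  apply: le_trans (sqr_le_expR w) _; rewrite -mulrA ler_wpM2l// -expRD ler_expR.
  nra.
  by rewrite ler_wpM2l ?mulr_ge0 ?expR_ge0// expR_norm_le.
by rewrite lee_fin expRD le_eqVlt; apply/orP; left; apply/eqP; ring.
Qed.

(* [1 - dotp_le3_gap] bounds the probability of {<v, e> <= 3}; it comes from
   shifting {<v, e> > -2} by 5 v, so that V = 25, with theta = 1. *)
Definition dotp_le3_gap : R :=
  expR (- (25 * (1 / 2 + 1))) * (1 - expR (- (3 / 2)) - expR (- (25 / 2))).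

Lemma dotp_le3_gap_gt0 : (0 < dotp_le3_gap)%R.
Proof.
rewrite mulr_gt0 ?expR_gt0//.
have : (expR (- (3 / 2)) <= 2 / 5 :> R)%R.
  by rewrite (le_trans (expRN_le (_ : 0 <= 3 / 2)%R))// -[leLHS]mul1r ler_pdivrMr; lra.
have : (expR (- (25 / 2)) <= 2 / 27 :> R)%R.
  by rewrite (le_trans (expRN_le (_ : 0 <= 25 / 2)%R))// -[leLHS]mul1r ler_pdivrMr; lra.
lra.
Qed.

Lemma integral_dotp_le3 :
  \int[std_gauss R n]_e ((dotp v e <= 3)%R%:R)%:E <= (1 - dotp_le3_gap)%:E.
Proof.
have mlt c : measurable_fun setT (fun e => (c < dotp v e)%R%:R : R).
  by apply: measurable_natr_bool; apply: measurable_fun_ltr => //; exact: measurable_dotp.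
have mle : measurable_fun setT (fun e => (dotp v e <= 3)%R%:R : R).
  by apply: measurable_natr_bool; apply: measurable_fun_ler => //; exact: measurable_dotp.
have tot : \int[std_gauss R n]_e ((dotp v e <= 3)%R%:R)%:E +
    \int[std_gauss R n]_e ((3 < dotp v e)%R%:R)%:E = 1.
  rewrite -ge0_integralD//; last 2 first.
  - exact/measurable_EFinP.
  - exact/measurable_EFinP.
  rewrite -(integral_cst_prob (std_gauss R n) 1); apply: eq_integral => e _.
  by rewrite -EFinD leNgt; case: ltP => _; rewrite ?add0r ?addr0.
(* Markov's inequality: exp(-2 - <v, e>) >= 1 where <v, e> <= -2, and its integral is exp(-2 +
   1/2). *)
have low : 1 <= \int[std_gauss R n]_e ((-2 < dotp v e)%R%:R)%:E +
    (expR (- (3 / 2)))%:E.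
  have -> : (expR (- (3 / 2)))%:E =
      \int[std_gauss R n]_e ((expR (- 2))%:E * (expR (-1 * dotp v e))%:E).
    rewrite ge0_integralZl_EFin ?expR_ge0//; last first.
      under eq_fun do rewrite -dotpZl.
      exact: measurable_EFin_expR_dotp.
    by rewrite integral_expR_dotp -EFinM -expRD; congr (expR _)%:E; field.
  rewrite -ge0_integralD//; last 2 first.
  - exact/measurable_EFinP.
  - apply: emeasurable_funM => //.
    under eq_fun do rewrite -dotpZl.
    exact: measurable_EFin_expR_dotp.
  rewrite -[leLHS](integral_cst_prob (std_gauss R n) 1).
  apply: ge0_le_integral => //.
  - apply: emeasurable_funD; first exact/measurable_EFinP.
    apply: emeasurable_funM => //.
    under eq_fun do rewrite -dotpZl.
    exact: measurable_EFin_expR_dotp.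
  - move=> e _; rewrite -EFinM -EFinD lee_fin -expRD.
    case: ltP => h; first by rewrite lerDl expR_ge0.
    by rewrite add0r -[leLHS]expR0 ler_expR; lra.
have shE : \int[std_gauss R n]_e ((-2 < dotp v (e - 5 *: v))%R%:R)%:E =
    \int[std_gauss R n]_e ((3 < dotp v e)%R%:R)%:E.
  apply: eq_integral => e _; congr ((_ : bool)%:R)%:E.
  by rewrite dotpDr dotpNr dotpZr v1 mulr1; apply/idP/idP; lra.
have v25 : (dotp (5 *: v) (5 *: v) <= 25)%R.
  by rewrite dotpZl dotpZr v1 mulr1 -natrM ler_nat.
have b01 e : (0 <= ((-2 < dotp v e)%R%:R : R) <= 1)%R.
  by rewrite ler0n lern1 leq_b1.
have := std_gauss_change_of_measure v25 ler01 (mlt _) b01; rewrite shE.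
move: tot low.
case: (\int[_]_e ((dotp v e <= 3)%R%:R)%:E) => [a| |]//;
  case: (\int[_]_e ((3 < dotp v e)%R%:R)%:E) => [b| |]//;
  case: (\int[_]_e ((-2 < dotp v e)%R%:R)%:E) => [c| |]//.
- rewrite -!EFinD -EFinM => -[ab1]; rewrite !lee_fin /dotp_le3_gap.
  rewrite (_ : 1 ^+ 2 * 25 / 2 = 25 / 2 :> R)%R; last by rewrite expr1n mul1r.
  have := expR_gt0 (- (25 * (1 / 2 + 1)) : R).
  set k := expR (- (25 * (1 / 2 + 1))); set r1 := expR (- (3 / 2)).
  set r2 := expR (- (25 / 2)) => k0 low kc.
  have : (0 <= k * (c + r1 - 1))%R by rewrite mulr_ge0 ?subr_ge0// ltW.
  by nra.
- by rewrite mulry gtr0_sg ?expR_gt0// mul1e.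
Qed.

End gauss_tails.

(** * Lower bounds *)

Section double_counting.

(** The pairs (S, j) with j in S correspond bijectively to the pairs (S', j) with j outside S',
    through S' = S minus j. *)
Lemma sum_draws_in_notin (T : finType) (V : nmodType) (m : nat)
    (g : {set T} -> T -> V) :
  \sum_(S : {set T} | #|S| == m.+1) \sum_(j in S) g S j =
  \sum_(S : {set T} | #|S| == m) \sum_(j in ~: S) g (j |: S) j.
Proof.
rewrite !pair_big_dep/=.
rewrite (reindex_onto (fun x : {set T} * T => (x.2 |: x.1, x.2))
                      (fun x : {set T} * T => (x.1 :\ x.2, x.2)))/=; last first.
  by move=> [S j] /= /andP[_ jS]; rewrite finset.setD1K.
apply: eq_bigl => -[S j] /=; rewrite !inE eqxx/= andbT xpair_eqE eqxx andbT.
rewrite cardsU1; have [jS|jS] := boolP (j \in S) => /=.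
  rewrite andbF; apply/negbTE/negP => /andP[_ /eqP eS].
  by move: jS; rewrite -eS !inE eqxx.
by rewrite finset.setU1K// eqxx andbT add1n eqSS.
Qed.

End double_counting.

(** * Expectations in the linear model *)

Section model.
Context {R : realType} {n p : nat}.
Implicit Types (X : 'M[R]_(n, p)) (beta : 'cV[R]_p).

Lemma measurable_model beta :
  measurable_fun setT (fun z : 'M[R]_(n, p) * 'cV[R]_n => (z.1, z.1 *m beta + z.2)).
Proof.
apply: measurable_fun_pair => //; apply/measurable_fun_entryP => i j.
apply: (eq_measurable_fun (fun z : 'M[R]_(n, p) * 'cV[R]_n =>
    \sum_k z.1 i k * beta k j + z.2 i j)) => [z _|]; first by rewrite !mxE.
apply: measurable_funD; last first.
  exact: (measurableT_comp (measurable_entry i j) measurable_snd).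
apply: measurable_sum => k; apply: measurable_funM => //.
exact: (measurableT_comp (measurable_entry i k) measurable_fst).
Qed.

(** Kept apart from [EXEbeta] because properties of the design, good columns or orthogonality, are
    used at a fixed X. *)
Definition Ebeta beta (f : 'M[R]_(n, p) * 'cV[R]_n -> R) X : \bar R :=
  (\int[std_gauss R n]_eps (f (X, X *m beta + eps)%R)%:E)%E.

Variable mu : probability 'M[R]_(n, p) R.
Implicit Types f g : 'M[R]_(n, p) * 'cV[R]_n -> R.
Local Open Scope ereal_scope.

Lemma EXEbetaE beta f : EXEbeta mu beta f = \int[mu]_X Ebeta beta f X.
Proof. by []. Qed.

Lemma measurable_EFin_model beta f : measurable_fun setT f ->
  measurable_fun setT (fun z : 'M[R]_(n, p) * 'cV[R]_n =>
    (f (z.1, z.1 *m beta + z.2)%R)%:E).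
Proof.
move=> mf; apply/measurable_EFinP.
exact: (measurableT_comp mf (measurable_model beta)).
Qed.

Lemma measurable_section_model beta f X : measurable_fun setT f ->
  measurable_fun setT (fun e => (f (X, X *m beta + e)%R)).
Proof.
move=> mf; apply/measurable_EFinP.
exact: (measurableT_comp (measurable_EFin_model beta mf) (pair1_measurable X)).
Qed.

Lemma measurable_Ebeta beta f : measurable_fun setT f -> (forall z, 0 <= f z)%R ->
  measurable_fun setT (Ebeta beta f).
Proof.
move=> mf f0; apply: (measurable_fun_fubini_tonelli_F _ (measurable_EFin_model beta mf)).
by move=> z; rewrite lee_fin.
Qed.

Lemma Ebeta_ge0 beta f X : (forall z, 0 <= f z)%R -> 0 <= Ebeta beta f X.
Proof. by move=> f0; apply: integral_ge0 => e _; rewrite lee_fin. Qed.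

Lemma EXEbeta_ge0 beta f : (forall z, 0 <= f z)%R -> 0 <= EXEbeta mu beta f.
Proof. by move=> f0; apply: integral_ge0 => X _; exact: Ebeta_ge0. Qed.

Lemma Ebeta_le beta f g X : measurable_fun setT f -> measurable_fun setT g ->
  (forall z, 0 <= f z <= g z)%R -> Ebeta beta f X <= Ebeta beta g X.
Proof.
move=> mf mg fg; apply: ge0_le_integral => //.
- by move=> e _; rewrite lee_fin; case/andP: (fg (X, X *m beta + e)%R).
- by apply/measurable_EFinP; exact: measurable_section_model.
- by apply/measurable_EFinP; exact: measurable_section_model.
- by move=> e _; rewrite lee_fin; case/andP: (fg (X, X *m beta + e)%R).
Qed.

Lemma EXEbeta_le beta f g : measurable_fun setT f -> measurable_fun setT g ->
  (forall z, 0 <= f z <= g z)%R -> EXEbeta mu beta f <= EXEbeta mu beta g.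
Proof.
move=> mf mg fg; have f0 z : (0 <= f z)%R by case/andP: (fg z).
have g0 z : (0 <= g z)%R by case/andP: (fg z) => /le_trans; exact.
apply: ge0_le_integral => //.
- by move=> X _; exact: Ebeta_ge0.
- exact: measurable_Ebeta.
- exact: measurable_Ebeta.
- by move=> X _; exact: Ebeta_le.
Qed.

Lemma EXEbeta_cst beta (c : R) : EXEbeta mu beta (fun=> c) = c%:E.
Proof.
rewrite EXEbetaE /Ebeta.
under eq_integral do rewrite integral_cst_prob.
exact: integral_cst_prob.
Qed.

Lemma EbetaD beta f g X : measurable_fun setT f -> measurable_fun setT g ->
  (forall z, 0 <= f z)%R -> (forall z, 0 <= g z)%R ->
  Ebeta beta (fun z => f z + g z)%R X = Ebeta beta f X + Ebeta beta g X.
Proof.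
move=> mf mg f0 g0; rewrite /Ebeta -ge0_integralD//.
- by move=> e _; rewrite lee_fin.
- by apply/measurable_EFinP; exact: measurable_section_model.
- by move=> e _; rewrite lee_fin.
- by apply/measurable_EFinP; exact: measurable_section_model.
Qed.

Lemma EXEbetaD beta f g : measurable_fun setT f -> measurable_fun setT g ->
  (forall z, 0 <= f z)%R -> (forall z, 0 <= g z)%R ->
  EXEbeta mu beta (fun z => f z + g z)%R = EXEbeta mu beta f + EXEbeta mu beta g.
Proof.
move=> mf mg f0 g0; rewrite !EXEbetaE -ge0_integralD//.
- by apply: eq_integral => X _; exact: EbetaD.
- by move=> X _; exact: Ebeta_ge0.
- exact: measurable_Ebeta.
- by move=> X _; exact: Ebeta_ge0.
- exact: measurable_Ebeta.
Qed.

Lemma EXEbetaZ beta f (c : R) : (0 <= c)%R -> measurable_fun setT f ->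
  (forall z, 0 <= f z)%R ->
  EXEbeta mu beta (fun z => c * f z)%R = c%:E * EXEbeta mu beta f.
Proof.
move=> c0 mf f0; rewrite !EXEbetaE -ge0_integralZl_EFin//; last 2 first.
- by move=> X _; exact: Ebeta_ge0.
- exact: measurable_Ebeta.
apply: eq_integral => X _; rewrite /Ebeta -ge0_integralZl_EFin//.
- by move=> e _; rewrite lee_fin.
- by apply/measurable_EFinP; exact: measurable_section_model.
Qed.

Lemma EXEbeta_sum beta (I : finType) (A : {set I})
    (f : I -> 'M[R]_(n, p) * 'cV[R]_n -> R) :
  (forall i, measurable_fun setT (f i)) -> (forall i z, 0 <= f i z)%R ->
  EXEbeta mu beta (fun z => \sum_(i in A) f i z)%R =
  \sum_(i in A) EXEbeta mu beta (f i).
Proof.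
move=> mf f0; rewrite -[RHS]big_enum/=.
under [in LHS]eq_fun do rewrite -big_enum/=.
elim: (enum _) => [|i r IHr].
  under eq_fun do rewrite big_nil.
  by rewrite big_nil EXEbeta_cst.
under eq_fun do rewrite big_cons.
rewrite EXEbetaD//; first by rewrite IHr big_cons.
- exact: measurable_sum.
- by move=> z; rewrite sumr_ge0.
Qed.

End model.

(** * Detections on and off the support *)

Section lower_bound.
Context {R : realType} {n p : nat}.
Variables (mu : probability 'M[R]_(n, p) R) (bh : @estimator R n p).

Definition beta_on (a : R) (S : {set 'I_p}) : 'cV[R]_p :=
  \col_j (if j \in S then a else 0).

Lemma l0norm_beta_on a S : (l0norm (beta_on a S) <= #|S|)%N.
Proof.
apply: subset_leq_card; apply/fintype.subsetP => j; rewrite !inE mxE.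
by case: ifP => //; rewrite eqxx.
Qed.

(** Adding j to the support translates y by a x_j, the vector to which the change of measure will be
    applied. *)
Lemma beta_onU1 a (S : {set 'I_p}) (j : 'I_p) (X : 'M[R]_(n, p)) : j \notin S ->
  X *m beta_on a (j |: S) = X *m beta_on a S + a *: col j X.
Proof.
move=> jS; apply/matrixP => i k; rewrite !mxE (bigD1 j)//= [in RHS](bigD1 j)//=.
rewrite !mxE !inE eqxx (negbTE jS)/= mulr0 add0r [RHS]addrC mulrC; congr (_ + _).
by apply: eq_bigr => l lj; rewrite !mxE !inE (negbTE lj).
Qed.

(** With a positive level u, one such event off the support counts both as a false positive and as
    at least u^2 of squared error. *)
Definition large (u : R) (j : 'I_p) (z : 'M[R]_(n, p) * 'cV[R]_n) : R :=
  (u <= `|bh z j 0|)%R%:R.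

Lemma measurable_bh (j : 'I_p) : measurable_fun setT (fun z => bh z j 0).
Proof.
exact: (measurableT_comp (measurable_entry j 0) (@measurable_funPT _ _ _ _ bh)).
Qed.

Lemma measurable_large u j : measurable_fun setT (large u j).
Proof.
apply: measurable_natr_bool; apply: measurable_fun_ler => //.
by apply: measurableT_comp => //; exact: measurable_bh.
Qed.

Lemma large_ge0 u j z : 0 <= large u j z. Proof. exact: ler0n. Qed.

Lemma large_le1 u j z : large u j z <= 1.
Proof. by rewrite /large lern1 leq_b1. Qed.

(** By [plargeE] nothing is lost through [fine]; real values let the double counting run in ordinary
    arithmetic. *)
Definition plarge (u : R) (beta : 'cV[R]_p) (j : 'I_p) : R :=
  fine (EXEbeta mu beta (large u j)).

Lemma plargeE u beta j : EXEbeta mu beta (large u j) = (plarge u beta j)%:E.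
Proof.
rewrite /plarge fineK// ge0_fin_numE; last by apply: EXEbeta_ge0; exact: large_ge0.
apply: (@le_lt_trans _ _ (EXEbeta mu beta (fun=> 1))).
  apply: EXEbeta_le => //; first exact: measurable_large.
  by move=> z; rewrite large_ge0 large_le1.
by rewrite EXEbeta_cst ltry.
Qed.

Lemma enorm_sqr m (v : 'cV[R]_m) : enorm v ^+ 2 = \sum_(i < m) v i 0 ^+ 2.
Proof. by rewrite sqr_sqrtr// sumr_ge0// => i _; exact: sqr_ge0. Qed.

Lemma measurable_sqr_error beta :
  measurable_fun setT (fun z => enorm (beta - bh z) ^+ 2).
Proof.
apply: (eq_measurable_fun (fun z => \sum_(i < p) (beta i 0 - bh z i 0) ^+ 2)).
  by move=> z _; rewrite enorm_sqr; apply: eq_bigr => i _; rewrite !mxE.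
apply: measurable_sum => i; apply: measurable_funX.
by apply: measurable_funB => //; exact: measurable_bh.
Qed.

Lemma EXEbeta_sum_large u beta (A : {set 'I_p}) :
  EXEbeta mu beta (fun z => \sum_(j in A) large u j z) =
  (\sum_(j in A) plarge u beta j)%:E.
Proof.
rewrite EXEbeta_sum; first last.
- by move=> j z; exact: large_ge0.
- by move=> j; exact: measurable_large.
by rewrite -sumEFin; apply: eq_bigr => j _; exact: plargeE.
Qed.

Lemma measurable_sum_large u (A : {set 'I_p}) :
  measurable_fun setT (fun z => \sum_(j in A) large u j z).
Proof.
under eq_fun do rewrite -big_enum/=.
by apply: measurable_sum => j; exact: measurable_large.
Qed.

(** A signal of height a estimated below kappa a in absolute value contributes at least ((1 - kappa)
    a)^2 to the squared error, so the risk limits the number of missed signals. *)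
Lemma plarge_on_support (a kappa B : R) (S : {set 'I_p}) :
  0 < a -> kappa < 1 ->
  (EXEbeta mu (beta_on a S) (fun z => enorm (beta_on a S - bh z) ^+ 2)%R <= B%:E)%E ->
  #|S|%:R * ((1 - kappa) * a) ^+ 2 <=
  B + ((1 - kappa) * a) ^+ 2 * \sum_(j in S) plarge (kappa * a) (beta_on a S) j.
Proof.
move=> a0 k1 risk; set c := ((1 - kappa) * a) ^+ 2.
have c0 : 0 <= c by exact: sqr_ge0.
rewrite -lee_fin EFinD [X in (_ <= _ + X)%E]EFinM -EXEbeta_sum_large -EXEbetaZ//; last 2 first.
- exact: measurable_sum_large.
- by move=> z; apply: sumr_ge0 => j _; exact: large_ge0.
apply: le_trans (leeD2r _ risk); rewrite -EXEbetaD//; last 4 first.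
- exact: measurable_sqr_error.
- by apply: measurable_funM => //; exact: measurable_sum_large.
- by move=> z; exact: sqr_ge0.
- by move=> z; rewrite mulr_ge0// sumr_ge0// => j _; exact: large_ge0.
rewrite -(EXEbeta_cst mu (beta_on a S)); apply: EXEbeta_le => //.
  apply: measurable_funD; first exact: measurable_sqr_error.
  by apply: measurable_funM => //; exact: measurable_sum_large.
move=> z; rewrite mulr_ge0//= enorm_sqr.
apply: (@le_trans _ _ (\sum_(j in S) ((beta_on a S - bh z) j 0 ^+ 2 +
    c * large (kappa * a) j z))); last first.
  rewrite big_split/= -mulr_sumr lerD2r [leRHS](bigID (mem S))/= lerDl.
  by apply: sumr_ge0 => j _; exact: sqr_ge0.
rewrite -mulr_natl mulr1 -sumr_const mulr_suml; apply: ler_sum => j jS.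
rewrite mul1r !mxE jS /large; have [_|lt] := leP (kappa * a) _.
  by rewrite mulr1 lerDr sqr_ge0.
rewrite mulr0 addr0 /c; have := ler_norm (bh z j 0).
by move=> le; rewrite ler_sqr ?nnegrE; nra.
Qed.

Lemma FP_ge_sum_large (u : R) (beta : 'cV[R]_p) (A : {set 'I_p}) z : 0 < u ->
  (forall j, j \in A -> beta j 0 = 0) ->
  \sum_(j in A) large u j z <= (FP (bh z) beta)%:R.
Proof.
have if0 (b : bool) : 0 <= (if b then 1%:R else 0 : R) by case: b.
move=> u0 A0; rewrite /FP -sum1_card natr_sum.
rewrite big_mkcond/= [leRHS]big_mkcond/=; apply: ler_sum => j _.
rewrite inE /large; have [/A0 ->|_] := boolP (j \in A); last exact: if0.
rewrite eqxx andbT; have [ub|_] := leP u `|bh z j 0|; last exact: if0.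
by rewrite ifT// -normr_gt0 (lt_le_trans u0).
Qed.

Lemma sqr_error_ge_sum_large (u : R) (beta : 'cV[R]_p) (A : {set 'I_p}) z : 0 <= u ->
  (forall j, j \in A -> beta j 0 = 0) ->
  u ^+ 2 * \sum_(j in A) large u j z <= enorm (beta - bh z) ^+ 2.
Proof.
move=> u0 A0; rewrite enorm_sqr [leRHS](bigID (mem A))/= -[leLHS]addr0 lerD//; last first.
  by apply: sumr_ge0 => j _; exact: sqr_ge0.
rewrite mulr_sumr; apply: ler_sum => j /A0 b0; rewrite !mxE b0 sub0r sqrrN /large.
have [ub|_] := leP u `|bh z j 0|; last by rewrite mulr0 sqr_ge0.
by rewrite mulr1 -[leRHS]real_normK ?num_real// ler_sqr ?nnegrE.
Qed.

Definition good_col (c3 : R) (i : 'I_p) : set 'M[R]_(n, p) :=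
  [set X | `|enorm (col i X) ^+ 2 / n%:R - 1| <= c3].

Lemma measurable_good_col c3 i : measurable (good_col c3 i).
Proof.
have mb : measurable_fun setT
    (fun X : 'M[R]_(n, p) => `|enorm (col i X) ^+ 2 / n%:R - 1| <= c3).
  apply: measurable_fun_ler => //; apply: measurableT_comp => //.
  apply: measurable_funB => //; apply: measurable_funM => //.
  apply: (eq_measurable_fun (fun X : 'M[R]_(n, p) => \sum_(k < n) X k i ^+ 2)).
    by move=> X _; rewrite enorm_sqr; apply: eq_bigr => k _; rewrite !mxE.
  by apply: measurable_sum => k; apply: measurable_funX; exact: measurable_entry.
have := mb measurableT [set true] I; rewrite setTI; congr measurable.
Qed.

Lemma dotp_enorm m (v : 'cV[R]_m) : dotp v v = enorm v ^+ 2.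
Proof. by rewrite enorm_sqr; apply: eq_bigr => i _; rewrite expr2. Qed.

(** For X with a good column j the change of measure applies with h = a x_j, whose squared norm is
    at most V. For the other X the left side is at most the exponential factor, and their
    probability is at most [pi0]. Both errors thus carry the same small factor as the main term and
    can be compared with it. *)
Lemma plarge_off_support (a u c3 V theta pi0 : R) (S : {set 'I_p}) (j : 'I_p) :
  (0 < n)%N -> 0 <= theta -> a ^+ 2 * (n%:R * (1 + c3)) <= V -> j \notin S ->
  ((1 - pi0)%:E <= mu (good_col c3 j))%E ->
  expR (- (V * (1 / 2 + theta))) * plarge u (beta_on a (j |: S)) j <=
  plarge u (beta_on a S) j +
  expR (- (V * (1 / 2 + theta))) * (expR (- (theta ^+ 2 * V / 2)) + pi0).
Proof.
move=> n0 t0 aV jS good; set k := expR _; set r := expR _.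
have k0 : 0 <= k by exact: expR_ge0.
have r0 : 0 <= r by exact: expR_ge0.
have mbad := measurableC (measurable_good_col c3 j).
have badP : (mu (~` good_col c3 j) <= pi0%:E)%E.
  rewrite probability_setC; last exact: measurable_good_col.
  have : mu (good_col c3 j) \is a fin_num.
    by apply: fin_num_measure; exact: measurable_good_col.
  move: good; case: (mu (good_col c3 j)) => [m| |]//=.
  by rewrite -EFinB !lee_fin => + _; lra.
have mL := measurable_large u j; have L0 := large_ge0 u j.
suff : (k%:E * EXEbeta mu (beta_on a (j |: S)) (large u j) <=
    EXEbeta mu (beta_on a S) (large u j) + (k * r)%:E + (k * pi0)%:E)%E.
  by rewrite !plargeE -!EFinM -!EFinD lee_fin mulrDr addrA.
apply: (@le_trans _ _ (EXEbeta mu (beta_on a S) (large u j) + (k * r)%:E +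
    k%:E * mu (~` good_col c3 j))%E); last first.
  by apply: leeD2l; rewrite EFinM lee_wpmul2l// lee_fin.
have -> : (k%:E * mu (~` good_col c3 j) =
    \int[mu]_X (k * \1_(~` good_col c3 j) X)%:E)%E.
  under eq_integral do rewrite EFinM.
  rewrite ge0_integralZl_EFin//; last by apply/measurable_EFinP; exact: measurable_indic.
  by rewrite integral_indic// setIT.
rewrite -[in (k * r)%:E](integral_cst_prob mu (k * r)) !EXEbetaE.
rewrite -ge0_integralD//; last 3 first.
- by move=> X _; exact: Ebeta_ge0.
- exact: measurable_Ebeta.
- by move=> X _; rewrite lee_fin mulr_ge0.
rewrite -ge0_integralD//; last 4 first.
- by move=> X _; rewrite adde_ge0 ?lee_fin ?mulr_ge0//; exact: Ebeta_ge0.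
- by apply: emeasurable_funD => //; exact: measurable_Ebeta.
- by move=> X _; rewrite lee_fin mulr_ge0.
- by apply/measurable_EFinP; apply: measurable_funM => //; exact: measurable_indic.
rewrite -ge0_integralZl_EFin//; last 2 first.
- by move=> X _; exact: Ebeta_ge0.
- exact: measurable_Ebeta.
apply: ge0_le_integral => //.
- by move=> X _; rewrite mule_ge0//; exact: Ebeta_ge0.
- by apply: emeasurable_funM => //; exact: measurable_Ebeta.
- apply: emeasurable_funD; first by apply: emeasurable_funD => //; exact: measurable_Ebeta.
  by apply/measurable_EFinP; apply: measurable_funM => //; exact: measurable_indic.
move=> X _; rewrite indicE; case: (boolP (X \in ~` good_col c3 j)) => [_|].
  rewrite mulr1 -[leLHS]add0e leeD//.
    by rewrite adde_ge0 ?lee_fin ?mulr_ge0//; exact: Ebeta_ge0.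
  rewrite -[leRHS]mule1 lee_wpmul2l// ?lee_fin//.
  rewrite -[leRHS](integral_cst_prob (std_gauss R n) 1).
  apply: ge0_le_integral => //.
  - by move=> e _; rewrite lee_fin.
  - by apply/measurable_EFinP; exact: measurable_section_model.
  - by move=> e _; rewrite lee_fin large_le1.
rewrite in_setC negbK inE => /= goodX; rewrite mulr0 adde0.
have hV : dotp (a *: col j X) (a *: col j X) <= V.
  rewrite dotpZl dotpZr dotp_enorm mulrA -expr2 (le_trans _ aV)//.
  rewrite ler_wpM2l ?sqr_ge0// mulrC -ler_pdivrMr ?ltr0n//.
  by move: goodX; rewrite /good_col/= ler_norml => /andP[_]; lra.
have := @std_gauss_change_of_measure R n _ V theta
  (fun e => large u j (X, X *m beta_on a (j |: S) + e)) hV t0.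
move=> /(_ (measurable_section_model _ _ mL)) cm.
apply: le_trans (cm _) _; first by move=> e; rewrite large_ge0 large_le1.
apply: leeD => //; rewrite le_eqVlt; apply/orP; left; apply/eqP.
apply: eq_integral => e _; rewrite beta_onU1//.
by congr (large u j (_, _))%:E; rewrite -addrA [_ + (e - _)]addrC subrK.
Qed.

End lower_bound.

Section lower_bound_average.
Context {R : realType} {n p m : nat}.
Variables (mu : probability 'M[R]_(n, p) R) (bh : @estimator R n p).
Variables (a kappa c3 V theta pi0 B F : R).
Hypotheses (n0 : (0 < n)%N) (mp : (m < p)%N) (a0 : 0 < a) (kappa1 : kappa < 1).
Hypotheses (theta0 : 0 <= theta) (aV : a ^+ 2 * (n%:R * (1 + c3)) <= V).
Hypothesis good : forall j, ((1 - pi0)%:E <= mu (good_col c3 j))%E.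
Hypothesis risk : forall S : {set 'I_p}, #|S| = m.+1 ->
  (EXEbeta mu (beta_on a S) (fun z => enorm (beta_on a S - bh z) ^+ 2)%R <= B%:E)%E.
Hypothesis count : forall S : {set 'I_p}, #|S| = m ->
  \sum_(j in ~: S) plarge mu bh (kappa * a) (beta_on a S) j <= F.

Lemma sum_draws_cst (x : R) (l : nat) :
  \sum_(S : {set 'I_p} | #|S| == l) x = 'C(p, l)%:R * x.
Proof. by rewrite -big_set/= sumr_const card_draws card_ord mulr_natl. Qed.

(* The average over S' of size m of the detections outside S' is, through
   S = j |: S', an average over S of size m + 1 of the detections inside S. *)
Lemma count_ge :
  (p - m)%:R * (expR (- (V * (1 / 2 + theta))) *
    (1 - B / (m.+1%:R * ((1 - kappa) * a) ^+ 2) -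
     expR (- (theta ^+ 2 * V / 2)) - pi0)) <= F.
Proof.
set k := expR _; set r := expR (- (theta ^+ 2 * V / 2)).
set c := ((1 - kappa) * a) ^+ 2.
have k0 : 0 < k by exact: expR_gt0.
have c0 : 0 < c by rewrite exprn_gt0// mulr_gt0// subr_gt0.
have N0 : 0 < 'C(p, m)%:R :> R by rewrite ltr0n bin_gt0 ltnW.
pose q S j := plarge mu bh (kappa * a) (beta_on a S) j.
have up : \sum_(S : {set 'I_p} | #|S| == m) \sum_(j in ~: S) k * q (j |: S) j <=
    'C(p, m)%:R * (F + (p - m)%:R * (k * (r + pi0))).
  rewrite -sum_draws_cst; apply: ler_sum => S /eqP Sm.
  have -> : (p - m)%:R * (k * (r + pi0)) = \sum_(j in ~: S) (k * (r + pi0)).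
    by rewrite sumr_const cardsCs finset.setCK Sm card_ord mulr_natl.
  apply: (@le_trans _ _ (\sum_(j in ~: S) (q S j + k * (r + pi0)))).
    apply: ler_sum => j; rewrite inE => jS.
    exact: (plarge_off_support _ _ n0 theta0 aV).
  by rewrite big_split/= lerD2r; exact: count.
have lo : 'C(p, m.+1)%:R * (k * (m.+1%:R - B / c)) <=
    \sum_(S : {set 'I_p} | #|S| == m) \sum_(j in ~: S) k * q (j |: S) j.
  rewrite -(sum_draws_in_notin _ (fun S j => k * q S j)) -sum_draws_cst.
  apply: ler_sum => S /eqP Sm; rewrite -mulr_sumr ler_wpM2l ?(ltW k0)//.
  have := plarge_on_support a0 kappa1 (risk Sm); rewrite Sm -/c => h.
  rewrite lerBlDr -(ler_pM2r c0) mulrDl divfK ?gt_eqF//.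
  by apply: le_trans h _; rewrite addrC (mulrC c).
have := le_trans lo up.
have M0 : m.+1%:R != 0 :> R by rewrite pnatr_eq0.
(* Both sides count the pairs of [sum_draws_in_notin]. *)
have bE : m.+1%:R * 'C(p, m.+1)%:R = (p - m)%:R * 'C(p, m)%:R :> R.
  by rewrite -!natrM mul_bin_left.
have -> : m.+1%:R - B / c = m.+1%:R * (1 - B / (m.+1%:R * c)).
  by move: M0; move: m.+1%:R => M M0; field; rewrite M0 gt_eqF.
set x := 1 - _.
rewrite (_ : _ * (k * (_ * x)) = (m.+1%:R * 'C(p, m.+1)%:R) * (k * x)); last by ring.
rewrite bE (_ : _ * _ * (k * x) = 'C(p, m)%:R * ((p - m)%:R * (k * x))); last by ring.
by rewrite ler_pM2l//; lra.
Qed.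

End lower_bound_average.

(** * False positives and risk at a fixed sample size *)

Section fixed_sample_size.
Context {R : realType} {n p s : nat}.
Variables (mu : probability 'M[R]_(n, p) R) (bh : @estimator R n p).

Lemma FP_sumE (betahat beta : 'cV[R]_p) :
  (FP betahat beta)%:R =
  \sum_(j in [set: 'I_p]%SET) ((betahat j 0 != 0) && (beta j 0 == 0))%:R :> R.
Proof.
rewrite /FP -sum1_card natr_sum big_mkcond [RHS]big_mkcond/=.
by apply: eq_bigr => j _; rewrite !inE; case: (_ && _).
Qed.

Lemma measurable_false_positive (beta : 'cV[R]_p) (j : 'I_p) :
  measurable_fun setT (fun z => ((bh z j 0 != 0) && (beta j 0 == 0))%:R : R).
Proof.
apply: measurable_natr_bool; apply: measurable_and => //.
by apply: measurable_neg; apply: measurable_fun_eqr => //; exact: measurable_bh.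
Qed.

Lemma measurable_FP (beta : 'cV[R]_p) :
  measurable_fun setT (fun z => (FP (bh z) beta)%:R : R).
Proof.
under eq_fun do rewrite FP_sumE -big_enum/=.
by apply: measurable_sum => j; exact: measurable_false_positive.
Qed.

Variables (c1 t kappa c3 theta pi0 : R).
Hypotheses (n0 : (0 < n)%N) (s0 : (0 < s)%N) (sp : (s < p)%N).
Hypotheses (t0 : 0 < t) (kappa0 : 0 < kappa) (kappa1 : kappa < 1).
Hypothesis theta0 : 0 <= theta.
Hypothesis good : forall j, ((1 - pi0)%:E <= mu (good_col c3 j))%E.
Hypothesis bhO : Omega s mu c1 bh.

Let L : R := ln (p%:R / s%:R).
(** Bound on |a x_j|^2 for a good column, since a^2 = t L / n. *)
Let V := t * L * (1 + c3).
(** The bound of [count_ge] with m = s - 1: the tested index is added to a support of size s - 1, so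
    that the enlarged one still has size s. With B = c1 s L / n the height a cancels and leaves c1 /
    ((1 - kappa)^2 t). *)
Let G := (p - s.-1)%:R * (expR (- (V * (1 / 2 + theta))) *
  (1 - c1 / ((1 - kappa) ^+ 2 * t) - expR (- (theta ^+ 2 * V / 2)) - pi0)).
Let a : R := Num.sqrt (t * L / n%:R).

Let L0 : 0 < L.
Proof. by rewrite ln_gt0// ltr_pdivlMr ?ltr0n// mul1r ltr_nat. Qed.

Let nR0 : 0 < n%:R :> R. Proof. by rewrite ltr0n. Qed.

Let a2 : a ^+ 2 = t * L / n%:R.
Proof. by rewrite sqr_sqrtr// divr_ge0// mulr_ge0// ltW. Qed.

Let a0 : 0 < a.
Proof. by rewrite sqrtr_gt0 divr_gt0// mulr_gt0. Qed.

Let sparse_beta_on (S : {set 'I_p}) : (#|S| <= s)%N -> sparse s (beta_on a S).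
Proof. exact/leq_trans/l0norm_beta_on. Qed.

Let risk (beta : 'cV[R]_p) : sparse s beta ->
  (EXEbeta mu beta (fun z => enorm (beta - bh z) ^+ 2)%R <=
    (c1 * s%:R * L / n%:R)%:E)%E.
Proof. by move=> sb; apply: le_trans bhO; apply: ereal_sup_ubound; exists beta. Qed.

Let count_ge_Omega (F : R) : (forall S : {set 'I_p}, #|S| = s.-1 ->
  \sum_(j in ~: S) plarge mu bh (kappa * a) (beta_on a S) j <= F) -> G <= F.
Proof.
move=> count.
have := @count_ge R n p s.-1 mu bh a kappa c3 V theta pi0 (c1 * s%:R * L / n%:R) F
  n0 _ a0 kappa1 theta0 _ good _ count.
rewrite prednK// exprMn a2.
rewrite (_ : _ / _ / (s%:R * _) = c1 / ((1 - kappa) ^+ 2 * t)); last first.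
  have [b0 sR0] : 1 - kappa != 0 /\ s%:R != 0 :> R.
    by rewrite subr_eq0 gt_eqF// pnatr_eq0 -lt0n.
  by field; rewrite b0 sR0 !gt_eqF.
apply.
- by rewrite (leq_trans _ sp)// ltnS leq_pred.
- rewrite /V le_eqVlt; apply/orP; left; apply/eqP; field.
  by rewrite gt_eqF.
- by move=> S Ss; apply: risk; apply: sparse_beta_on; rewrite Ss.
Qed.

Let off_support (S : {set 'I_p}) j : j \in ~: S -> beta_on a S j 0 = 0.
Proof. by rewrite inE mxE => /negbTE ->. Qed.

Let sum_large_le_EXEbeta (S : {set 'I_p}) (f : 'M[R]_(n, p) * 'cV[R]_n -> R) :
  measurable_fun setT f ->
  (forall z, \sum_(j in ~: S) large bh (kappa * a) j z <= f z) ->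
  ((\sum_(j in ~: S) plarge mu bh (kappa * a) (beta_on a S) j)%:E <=
    EXEbeta mu (beta_on a S) f)%E.
Proof.
move=> mf lef; rewrite -EXEbeta_sum_large; apply: EXEbeta_le => //.
  exact: measurable_sum_large.
by move=> z; rewrite lef andbT sumr_ge0// => j _; exact: large_ge0.
Qed.

Lemma sup_FP_ge : (G%:E <= sup_FP s mu bh)%E.
Proof.
have le_sup (S : {set 'I_p}) : #|S| = s.-1 ->
    ((\sum_(j in ~: S) plarge mu bh (kappa * a) (beta_on a S) j)%:E <=
      sup_FP s mu bh)%E.
  move=> Ss; apply: (@le_trans _ _ (EXEbeta mu (beta_on a S)
      (fun z => (FP (bh z) (beta_on a S))%:R))).
    apply: sum_large_le_EXEbeta; first exact: measurable_FP.
    by move=> z; apply: FP_ge_sum_large; [rewrite mulr_gt0|exact: off_support].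
  apply: ereal_sup_ubound; exists (beta_on a S) => //.
  by apply: sparse_beta_on; rewrite Ss leq_pred.
move: le_sup; case: (sup_FP s mu bh) => [F| |] h.
- by rewrite lee_fin; apply: count_ge_Omega => S Ss; rewrite -lee_fin; exact: h.
- exact: leey.
(* The value -oo is excluded by exhibiting one support of size s - 1, which exists because s - 1 <=
   p. *)
- rewrite leeNy_eq; apply/eqP.
  have [S Ss] : exists S : {set 'I_p}, #|S| = s.-1.
    have : (0 < #|[set S : {set 'I_p} | #|S| == s.-1]%SET|)%N.
      by rewrite card_draws card_ord bin_gt0 (leq_trans (leq_pred _))// ltnW.
    by case/card_gt0P => S; rewrite inE => /eqP; exists S.
  by have := h S Ss; rewrite leeNy_eq.
Qed.

(** Each false detection costs (kappa a)^2, so the risk bound also caps their number; the common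
    factor L / n cancels. This is the inequality that will empty Omega when c1 < 2. *)
Lemma sqr_error_ge : kappa ^+ 2 * t * G <= c1 * s%:R.
Proof.
have u0 : 0 < (kappa * a) ^+ 2 by rewrite exprn_gt0// mulr_gt0.
have : G <= c1 * s%:R * L / n%:R / (kappa * a) ^+ 2.
  apply: count_ge_Omega => S Ss; rewrite ler_pdivlMr// mulrC -lee_fin EFinM.
  rewrite -EXEbeta_sum_large -EXEbetaZ ?(ltW u0)//; last 2 first.
  - exact: measurable_sum_large.
  - by move=> z; rewrite sumr_ge0// => j _; exact: large_ge0.
  have sS : (#|S| <= s)%N by rewrite Ss leq_pred.
  apply: le_trans (risk (sparse_beta_on sS)).
  apply: EXEbeta_le.
  - by apply: measurable_funM => //; exact: measurable_sum_large.
  - exact: measurable_sqr_error.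
  move=> z; rewrite mulr_ge0 ?(ltW u0)//=.
    by apply: sqr_error_ge_sum_large; [rewrite ltW// mulr_gt0|exact: off_support].
  by rewrite sumr_ge0// => j _; exact: large_ge0.
rewrite ler_pdivlMr// exprMn a2 => h.
have d0 : 0 < L / n%:R by rewrite divr_gt0.
by rewrite -(ler_pM2r d0); move: h; congr (_ <= _); ring.
Qed.

End fixed_sample_size.

(** * Asymptotics in the dense and sparse regimes *)

Section asymptotics.
Context {R : realType}.

(* delta n is 1 / (k + 1) for the largest k <= n such that P n (1 / (k + 1)). *)
Lemma diagonal_vanishing (P : nat -> R -> Prop) :
  (forall eps, 0 < eps -> \forall n \near \oo, P n eps) ->
  exists2 delta : nat -> R, delta @ \oo --> (0 : R) &
    \forall n \near \oo, P n (delta n).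
Proof.
move=> HP; pose Q n k := `[< P n (k.+1%:R^-1) >].
pose k n := (\max_(i < n.+1 | Q n i) i)%N.
have kP K : \forall n \near \oo, (K <= k n)%N /\ P n ((k n).+1%:R^-1).
  have K0 : 0 < K.+1%:R^-1 :> R by rewrite invr_gt0.
  near=> n.
  have Kn : (K < n.+1)%N by near: n; exact: nbhs_infty_ge.
  have PK : P n (K.+1%:R^-1) by near: n; exact: HP.
  have QK : Q n (Ordinal Kn) by exact/asboolP.
  split; first exact: (@bigop.leq_bigmax_cond _ (fun i : 'I_n.+1 => Q n i)
    (fun i => i : nat) (Ordinal Kn) QK).
  have [|i Qi ki] := @bigop.eq_bigmax_cond _ (fun i : 'I_n.+1 => Q n i) (fun i => i : nat).
    by apply/card_gt0P; exists (Ordinal Kn).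
  by rewrite /k ki; exact/asboolP.
exists (fun n => (k n).+1%:R^-1); last by apply: filterS (kP 0%N) => n [].
apply/cvgr0Pnorm_lt => eps eps0.
have /cvgr0Pnorm_lt/(_ _ eps0)[K _ /(_ K (leqnn K)) /= hK] := @cvg_harmonic R.
apply: filterS (kP K) => n [Kn _]; apply: le_lt_trans hK.
rewrite !ger0_norm ?invr_ge0// lef_pV2 ?posrE ?ltr0n// ler_nat ltnS.
exact: Kn.
Unshelve. all: by end_near. Qed.

Variables (p s : nat -> nat) (mu : forall n : nat, probability 'M[R]_(n, p n) R).
Hypothesis Hsp : forall n : nat, (1 <= s n <= p n)%N.
Hypothesis Hdesign : forall c3 : R, 0 < c3 ->
  \big[Order.min/1%E]_(i < p n)
    mu n [set X | `|enorm (col i X) ^+ 2 / n%:R - 1| <= c3]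
  @[n --> \oo] --> 1%E.

Local Notation x n := ((s n)%:R / (p n)%:R : R).
Local Notation L n := (ln ((p n)%:R / (s n)%:R) : R).

Lemma p_gt0 n : 0 < (p n)%:R :> R.
Proof. by rewrite ltr0n; have /andP[/leq_trans] := Hsp n; exact. Qed.

Lemma s_gt0 n : 0 < (s n)%:R :> R.
Proof. by rewrite ltr0n; case/andP: (Hsp n). Qed.

Lemma ratio_gt0 n : 0 < x n. Proof. by rewrite divr_gt0 ?p_gt0 ?s_gt0. Qed.

Lemma log_ratioE n : L n = - ln (x n).
Proof. by rewrite -lnV ?posrE ?ratio_gt0// invf_div. Qed.

Lemma ratio_powRE n c : x n `^ c = expR (- (c * L n)).
Proof. by rewrite /powR gt_eqF ?ratio_gt0// log_ratioE mulrN opprK. Qed.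

Lemma log_ratio_ge n A : x n <= expR (- A) -> A <= L n.
Proof.
move=> xA; rewrite log_ratioE lerNr -(expRK (- A)).
by rewrite ler_ln ?posrE ?ratio_gt0 ?expR_gt0.
Qed.

Lemma log_ratio_le n A : expR (- A) <= x n -> L n <= A.
Proof.
move=> xA; rewrite log_ratioE lerNl -(expRK (- A)).
by rewrite ler_ln ?posrE ?ratio_gt0 ?expR_gt0.
Qed.

Lemma ratio_lt1 n : x n < 1 -> (s n < p n)%N.
Proof. by rewrite ltr_pdivrMr ?p_gt0// mul1r ltr_nat. Qed.

(** The minimum over the columns makes the rank beyond which the bound holds independent of j. *)
Lemma near_good_col (c3 pi0 : R) : 0 < c3 -> 0 < pi0 ->
  \forall n \near \oo, forall j, ((1 - pi0)%:E <= mu n (good_col c3 j))%E.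
Proof.
move=> c30 pi00.
have lt1 : (1 - pi0 < 1 :> R) by rewrite ltrBlDr ltrDl.
have N1 : nbhs (1%:E : \bar R) [set y | ((1 - pi0)%:E < y)%E].
  exact: (@nbhs_open_ereal_gt R 1 (fun r => r - pi0) lt1).
have := Hdesign c30 N1; rewrite /nbhs/=.
apply: filterS => n /= lt j; apply: (le_trans (ltW lt)).
exact: bigmin_le.
Qed.

(** The two error terms consume at most half of [eta], and a proportion [rho] of the indices stays
    outside the support. *)
Lemma lower_bound_simplify (P S : nat) (e eta r pi0 rho : R) :
  (0 < S)%N -> 0 <= e -> 0 <= eta -> r <= eta / 4 -> pi0 <= eta / 4 ->
  S%:R <= (1 - rho) * P%:R -> 0 <= rho ->
  rho * P%:R * (e * (eta / 2)) <= (P - S.-1)%:R * (e * (eta - r - pi0)).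
Proof.
move=> S0 e0 eta0 r4 pi4 Srho rho0; apply: ler_pM.
- by rewrite mulr_ge0.
- by rewrite !mulr_ge0.
- have : P%:R - S%:R <= (P - S.-1)%:R :> R.
    rewrite lerBlDr -natrD ler_nat; move: S0; lia.
  by lra.
- by rewrite ler_wpM2l//; lra.
Qed.

Variable c1 : R.
Hypothesis c10 : 0 < c1.

(** Here L stays between two positive constants. As V is then bounded, the tail exp(- theta^2 V / 2)
    is made small by a large theta, and exp(- V (1/2 + theta)) remains bounded below. *)
Lemma dense_lower_bound (zeta : R) : 0 < zeta < 1 ->
  x n @[n --> \oo] --> zeta ->
  exists2 C : R, 0 < C & \forall n \near \oo,
    ((C * (p n)%:R)%:E <= minimax_FP (s n) (mu n) c1)%E.
Proof.
move=> /andP[z0 z1] xz.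
pose L0 : R := - ln ((1 + zeta) / 2); pose L1 : R := - ln (zeta / 2).
have L00 : 0 < L0 by rewrite oppr_gt0 ln_lt0//; lra.
(* Chosen so that c1 L0 theta^2 >= 1; with V = 16 c1 L this makes theta^2 V / 2 at least 8. *)
pose theta := 1 + (c1 * L0)^-1.
have cL0 : 0 < c1 * L0 by exact: mulr_gt0.
have theta0 : 0 <= theta by rewrite addr_ge0// invr_ge0 ltW.
exists ((1 - zeta) / 2 * (expR (- (16 * c1 * L1 * (1 / 2 + theta))) * (1 / 4))).
  by rewrite !mulr_gt0 ?expR_gt0//; lra.
near=> n.
have n0 : (0 < n)%N by near: n; exact: nbhs_infty_gt.
have s0 : (0 < s n)%N by case/andP: (Hsp n).
have xlo : zeta / 2 <= x n by near: n; apply: (cvgr_ge _ xz); lra.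
have xhi : x n <= (1 + zeta) / 2 by near: n; apply: (cvgr_le _ xz); lra.
have good : forall j, ((1 - 1 / 8)%:E <= mu n (good_col 1 j))%E.
  by near: n; apply: near_good_col; lra.
have sp : (s n < p n)%N by apply: ratio_lt1; apply: le_lt_trans xhi _; lra.
have LL0 : L0 <= L n by apply: log_ratio_ge; rewrite opprK lnK// posrE; lra.
have LL1 : L n <= L1 by apply: log_ratio_le; rewrite opprK lnK// posrE; lra.
apply/ereal_infP => _ [bh bhO <-].
(* With t = 8 c1 and kappa = 1/2, c1 / ((1 - kappa)^2 t) = 1/2: at least half of the signals are
   detected. *)
have [t0 k0 k1] : [/\ 0 < 8 * c1, 0 < 1 / 2 :> R & 1 / 2 < 1 :> R].
  by split; [exact: mulr_gt0|lra|lra].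
have := sup_FP_ge n0 s0 sp t0 k0 k1 theta0 good bhO.
apply: le_trans; rewrite lee_fin.
have -> : 1 - c1 / ((1 - 1 / 2) ^+ 2 * (8 * c1)) = 1 / 2 :> R.
  by field; rewrite gt_eqF.
set V := 8 * c1 * L n * (1 + 1).
have Lpos : 0 < L n by exact: lt_le_trans LL0.
have r4 : expR (- (theta ^+ 2 * V / 2)) <= 1 / 2 / 4.
  have V8 : 7 <= theta ^+ 2 * V / 2.
    have cLt : 1 <= c1 * L0 * theta ^+ 2.
      have ct : c1 * L0 * theta = c1 * L0 + 1.
        by rewrite /theta mulrDr mulr1 mulfV ?gt_eqF.
      have theta1 : 1 <= theta by rewrite lerDl invr_ge0 ltW.
      by rewrite expr2 mulrA ct; nra.
    have : c1 * L0 * theta ^+ 2 <= c1 * L n * theta ^+ 2.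
      by rewrite ler_wpM2r ?sqr_ge0// ler_wpM2l// ltW.
    by rewrite /V; lra.
  apply: le_trans (expRN_le (le_trans _ V8)) _; first by lra.
  by rewrite -[leLHS]mul1r ler_pdivrMr; lra.
have xP : (s n)%:R <= (1 - (1 - zeta) / 2) * (p n)%:R.
  by rewrite -ler_pdivrMr ?p_gt0//; apply: le_trans xhi _; lra.
have [e0 p4 rho0] : [/\ 0 <= 1 / 2 :> R, 1 / 8 <= 1 / 2 / 4 :> R & 0 <= (1 - zeta) / 2].
  by split; lra.
apply: (le_trans _ (lower_bound_simplify s0 (expR_ge0 _) e0 r4 p4 xP rho0)).
rewrite mulrAC ler_wpM2l//; first by rewrite mulr_ge0.
have : expR (- (16 * c1 * L1 * (1 / 2 + theta))) <= expR (- (V * (1 / 2 + theta))).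
  rewrite ler_expR lerN2 ler_wpM2r//; first by lra.
  have : c1 * L n <= c1 * L1 by rewrite ler_wpM2l// ltW.
  by rewrite /V; lra.
lra.
Unshelve. all: by end_near. Qed.

(** Now L tends to infinity, so theta can be small and the exponent approaches c1/2. The second
    conclusion compares the same quantity with the risk budget. *)
Lemma sparse_lower_bound (eps : R) : 0 < eps -> x n @[n --> \oo] --> (0 : R) ->
  exists2 C : R, 0 < C & exists2 D : R, 0 < D & \forall n \near \oo,
  forall bh, Omega (s n) (mu n) c1 bh ->
    ((C * (p n)%:R * x n `^ (c1 / 2 + eps))%:E <= sup_FP (s n) (mu n) bh)%E /\
    D * ((p n)%:R * x n `^ (c1 / 2 + eps)) <= (s n)%:R.
Proof.
move=> eps0 x0.
(* One parameter controls every loss: t, c3 and theta each contribute a factor 1 + w, and c1 (1 +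
   w)^3 / 2 <= c1 (1 + 7 w) / 2 <= c1/2 + eps. *)
pose w := Num.min (1 / 2) (eps / (4 * c1)).
have w2 : w <= 1 / 2 by rewrite ge_min lexx.
have weps : 4 * c1 * w <= eps.
  by rewrite mulrC -ler_pdivlMr ?mulr_gt0// ge_min lexx orbT.
have w0 : 0 < w.
  rewrite lt_min; apply/andP; split; first by lra.
  by apply: divr_gt0 => //; exact: mulr_gt0.
pose t := c1 * (1 + w); pose kappa := w / 4; pose theta := w / 2.
have t0 : 0 < t by rewrite mulr_gt0//; lra.
have kappa0 : 0 < kappa by rewrite divr_gt0.
have kappa1 : kappa < 1 by rewrite /kappa; lra.
have theta0 : 0 <= theta by rewrite divr_ge0// ltW.
(* Guaranteed proportion of detected signals, positive because (1 - w/4)^2 (1 + w) > 1. *)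
pose eta := 1 - c1 / ((1 - kappa) ^+ 2 * t).
have kt : 0 < (1 - kappa) ^+ 2 * t by rewrite mulr_gt0// exprn_gt0// subr_gt0.
have eta0 : 0 < eta.
  rewrite subr_gt0 ltr_pdivrMr// mul1r /t /kappa mulrCA ltr_pMr//.
  by nra.
pose C := 1 / 2 * (eta / 2).
have C0 : 0 < C by rewrite /C; lra.
exists C => //; exists (kappa ^+ 2 * t * C / c1).
  by rewrite divr_gt0// mulr_gt0// mulr_gt0// exprn_gt0.
near=> n => bh bhO.
have n0 : (0 < n)%N by near: n; exact: nbhs_infty_gt.
have s0 : (0 < s n)%N by case/andP: (Hsp n).
have good : forall j, ((1 - eta / 4)%:E <= mu n (good_col w j))%E.
  by near: n; apply: near_good_col => //; lra.
have x2 : x n <= 1 / 2 by near: n; apply: (cvgr_le _ x0); lra.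
(* L >= A makes theta^2 V / 2 at least 4 / eta, whence a tail of at most eta / 4 by [expRN_le]. *)
pose A := (eta / 4)^-1 / (theta ^+ 2 * t * (1 + w) / 2).
have LA : A <= L n.
  by apply: log_ratio_ge; near: n; apply: (cvgr_le _ x0); exact: expR_gt0.
have sp : (s n < p n)%N by apply: ratio_lt1; apply: le_lt_trans x2 _; lra.
have Lpos : 0 <= L n.
  by rewrite ln_ge0// ler_pdivlMr ?s_gt0// mul1r ler_nat ltnW.
set V := t * L n * (1 + w).
have th2 : 0 < theta ^+ 2 * t * (1 + w) / 2.
  by rewrite divr_gt0// mulr_gt0 ?mulr_gt0 ?exprn_gt0 ?divr_gt0//; lra.
have r4 : expR (- (theta ^+ 2 * V / 2)) <= eta / 4.
  have VA : (eta / 4)^-1 <= theta ^+ 2 * V / 2.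
    move: LA; rewrite ler_pdivrMr// => /le_trans; apply.
    by rewrite le_eqVlt; apply/orP; left; apply/eqP; rewrite /V; ring.
  have e40 : 0 < (eta / 4)^-1 by rewrite invr_gt0; lra.
  apply: le_trans (expRN_le (le_trans (ltW e40) VA)) _.
  rewrite -[leRHS]invrK lef_pV2 ?posrE//; first by lra.
  by lra.
have xP : (s n)%:R <= (1 - 1 / 2) * (p n)%:R :> R.
  by rewrite -ler_pdivrMr ?p_gt0//; apply: le_trans x2 _; lra.
have half0 : 0 <= 1 / 2 :> R by lra.
have powle : x n `^ (c1 / 2 + eps) <= expR (- (V * (1 / 2 + theta))).
  rewrite ratio_powRE ler_expR lerN2 /V /theta /t.
  rewrite (_ : _ * _ = c1 * (1 + w) ^+ 3 / 2 * L n); last by field.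
  rewrite ler_wpM2r//.
  have : c1 * (1 + w) ^+ 3 <= c1 * (1 + 7 * w).
    by rewrite ler_wpM2l ?(ltW c10)//; nra.
  lra.
have := lower_bound_simplify s0 (expR_ge0 (- (V * (1 / 2 + theta)))) (ltW eta0)
  r4 (lexx _) xP half0.
set G := (_ - _)%:R * _ => lowG.
have GC : C * (p n)%:R * x n `^ (c1 / 2 + eps) <= G.
  apply: le_trans lowG; rewrite /C.
  rewrite (_ : _ * _ * _ * _ = 1 / 2 * (p n)%:R * (x n `^ (c1 / 2 + eps) * (eta / 2))).
    by rewrite ler_wpM2l ?mulr_ge0// ler_wpM2r//; lra.
  by ring.
split.
  apply: le_trans (sup_FP_ge n0 s0 sp t0 kappa0 kappa1 theta0 good bhO).
  by rewrite lee_fin.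
have := sqr_error_ge n0 s0 sp t0 kappa0 kappa1 theta0 good bhO.
rewrite -/eta -/V -/G => hG.
rewrite -(ler_pM2l c10); apply: le_trans hG.
rewrite [leLHS](_ : _ = kappa ^+ 2 * t * (C * (p n)%:R * x n `^ (c1 / 2 + eps))).
  by rewrite ler_wpM2l// mulr_ge0 ?sqr_ge0// ltW.
by field; rewrite gt_eqF.
Unshelve. all: by end_near. Qed.

Lemma near_ratio_powR_le (c u : R) : 0 < c -> 0 < u ->
  x n @[n --> \oo] --> (0 : R) -> \forall n \near \oo, x n `^ c <= u.
Proof.
move=> c0 u0 x0; near=> n.
have : - ln u / c <= L n.
  by apply: log_ratio_ge; near: n; apply: (cvgr_le _ x0); exact: expR_gt0.
rewrite ler_pdivrMr// => h.
by rewrite ratio_powRE -[leRHS]lnK ?posrE// ler_expR lerNl mulrC.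
Unshelve. all: by end_near. Qed.

(** The constant of [sparse_lower_bound] depends on eps. Applied at eps / 2, it leaves a factor
    (s/p)^(eps/2) that tends to 0 and absorbs the ratio of constants; hence C can be prescribed in
    advance. *)
Lemma sparse_minimax_lower_bound (C : R) : 0 < C -> x n @[n --> \oo] --> (0 : R) ->
  exists2 delta : nat -> R, delta @ \oo --> (0 : R) & \forall n \near \oo,
    ((C * (p n)%:R * x n `^ (c1 / 2 + delta n))%:E <= minimax_FP (s n) (mu n) c1)%E.
Proof.
move=> C0 x0.
pose P n e := ((C * (p n)%:R * x n `^ (c1 / 2 + e))%:E <= minimax_FP (s n) (mu n) c1)%E.
apply: (@diagonal_vanishing P) => eps eps0.
have eps20 : 0 < eps / 2 by rewrite divr_gt0.
have [C' C'0 [D _ lb]] := sparse_lower_bound eps20 x0.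
have CC0 : 0 < C' / C by rewrite divr_gt0.
have pw := near_ratio_powR_le eps20 CC0 x0.
near=> n; apply/ereal_infP => _ [bh bhO <-].
have xe : x n `^ (eps / 2) <= C' / C by near: n.
have [] : ((C' * (p n)%:R * x n `^ (c1 / 2 + eps / 2))%:E <= sup_FP (s n) (mu n) bh)%E /\
    D * ((p n)%:R * x n `^ (c1 / 2 + eps / 2)) <= (s n)%:R.
  by move: bh bhO; near: n.
move=> le _; apply: le_trans le; rewrite lee_fin.
have -> : c1 / 2 + eps = c1 / 2 + eps / 2 + eps / 2 by field.
rewrite [in leLHS]powRD; last by apply/implyP => _; rewrite gt_eqF ?ratio_gt0.
set y := _ `^ (c1 / 2 + eps / 2).
have y0 : 0 <= (p n)%:R * y by rewrite mulr_ge0 ?powR_ge0.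
rewrite [leLHS](_ : _ = C * x n `^ (eps / 2) * ((p n)%:R * y)); last by ring.
rewrite [leRHS](_ : _ = C' * ((p n)%:R * y)); last by ring.
by rewrite ler_wpM2r// mulrC -ler_pdivlMr.
Unshelve. all: by end_near. Qed.

Lemma near_Omega_empty : c1 < 2 -> x n @[n --> \oo] --> (0 : R) ->
  \forall n \near \oo, ~ (Omega (s n) (mu n) c1 !=set0).
Proof.
(* Then c1/2 + 2 eps = 1, so s = p (s/p)^(c1/2 + eps) (s/p)^eps with a last factor tending to 0,
   against the second conclusion of [sparse_lower_bound]. *)
move=> c12 x0; pose eps := (2 - c1) / 4.
have eps0 : 0 < eps by rewrite /eps; lra.
have [C _ [D D0 lb]] := sparse_lower_bound eps0 x0.
have pw := near_ratio_powR_le eps0 (divr_gt0 D0 (ltr0Sn _ 1)) x0.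
near=> n => -[bh bhO].
have [_] : ((C * (p n)%:R * x n `^ (c1 / 2 + eps))%:E <= sup_FP (s n) (mu n) bh)%E /\
    D * ((p n)%:R * x n `^ (c1 / 2 + eps)) <= (s n)%:R.
  by move: bh bhO; near: n; exact: lb.
have xe : x n `^ eps <= D / 2 by near: n.
have sE : (s n)%:R = (p n)%:R * (x n `^ (c1 / 2 + eps) * x n `^ eps).
  rewrite -powRD; last by apply/implyP => _; rewrite gt_eqF ?ratio_gt0.
  rewrite (_ : c1 / 2 + eps + eps = 1); last by rewrite /eps; field.
  by rewrite powRr1 ?(ltW (ratio_gt0 _))// mulrC divfK// gt_eqF ?p_gt0.
apply/negP; rewrite -ltNge [ltLHS]sE [ltRHS]mulrCA ltr_pM2l ?p_gt0// [ltRHS]mulrC ltr_pM2l.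
  by apply: le_lt_trans xe _; lra.
by rewrite powR_gt0 ?ratio_gt0.
Unshelve. all: by end_near. Qed.

End asymptotics.

(** * Hard thresholding *)

Section thresholding_risk.
Context {R : realType}.

(** Squared error of hard thresholding b + w at lam as an estimate of b: the noise remains if the
    observation is kept, the signal is lost otherwise. *)
Definition rho (lam b w : R) : R := if lam < `|b + w| then w ^+ 2 else b ^+ 2.

Lemma rho_ge0 lam b w : 0 <= rho lam b w.
Proof. by rewrite /rho; case: ifP => _; exact: sqr_ge0. Qed.

Lemma rhoN lam b w : rho lam (- b) (- w) = rho lam b w.
Proof. by rewrite /rho -opprD normrN !sqrrN. Qed.

Lemma measurable_rho n (v : 'cV[R]_n) lam b :
  measurable_fun setT (fun e => rho lam b (dotp v e)).
Proof.
apply: measurable_fun_ifT => //.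
  apply: measurable_fun_ltr => //; apply: measurableT_comp => //.
  by apply: measurable_funD => //; exact: measurable_dotp.
by apply: measurable_funX; exact: measurable_dotp.
Qed.

Let K2 : R := 8 * expR (1 / 2).

Let K2_gt0 : 0 < K2. Proof. by rewrite mulr_gt0 ?expR_gt0. Qed.

Let gap := @dotp_le3_gap R.

Lemma integral_rho_le_sqr n (v : 'cV[R]_n) (lam b A B : R) (D : R -> bool) :
  dotp v v = 1 -> 0 <= A -> 0 <= B ->
  measurable_fun setT (fun e => D (dotp v e)) ->
  (forall w, rho lam b w <= A * w ^+ 2 + B * (D w)%:R) ->
  (\int[std_gauss R n]_e (rho lam b (dotp v e))%:E <=
   (A * K2)%:E + B%:E * \int[std_gauss R n]_e ((D (dotp v e))%:R)%:E)%E.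
Proof.
move=> v1 A0 B0 mD le.
have mD' : measurable_fun setT (fun e => ((D (dotp v e))%:R : R)%:E).
  by apply/measurable_EFinP; exact: measurable_natr_bool.
have mS : measurable_fun setT (fun e => (dotp v e ^+ 2)%:E).
  by apply/measurable_EFinP; apply: measurable_funX; exact: measurable_dotp.
apply: (@le_trans _ _ (\int[std_gauss R n]_e (A%:E * (dotp v e ^+ 2)%:E +
    B%:E * ((D (dotp v e))%:R)%:E))%E).
  apply: ge0_le_integral => //.
  - by move=> e _; rewrite lee_fin rho_ge0.
  - by apply/measurable_EFinP; exact: measurable_rho.
  - by apply: emeasurable_funD; apply: emeasurable_funM.
  - by move=> e _; rewrite -!EFinM -EFinD lee_fin.
rewrite ge0_integralD//; last 4 first.
- by move=> e _; rewrite mule_ge0// lee_fin sqr_ge0.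
- exact: emeasurable_funM.
- by move=> e _; rewrite mule_ge0// lee_fin.
- exact: emeasurable_funM.
rewrite ge0_integralZl_EFin//; last by move=> e _; rewrite lee_fin sqr_ge0.
rewrite ge0_integralZl_EFin//.
rewrite leeD2r// EFinM lee_wpmul2l// ?lee_fin//; exact: integral_sqr_dotp.
Qed.

Lemma gap_le1 n (v : 'cV[R]_n) : dotp v v = 1 -> gap <= 1.
Proof.
move=> v1; have := integral_dotp_le3 v1.
move=> /(le_trans _) => /(_ 0%E); rewrite lee_fin subr_ge0; apply.
by apply: integral_ge0 => e _; rewrite lee_fin.
Qed.

Lemma le_minus_linear (lam K C : R) : 0 <= K -> 0 <= C -> 2 + K + C <= lam ->
  K <= lam ^+ 2 - 2 * lam - C.
Proof. by move=> K0 C0 h; nra. Qed.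

(* Near b = lam the estimator still recovers b with probability at least
   [dotp_le3_gap], which beats any linear term in lam. *)
Lemma integral_rho_le (C : R) : 0 <= C -> exists lam0 : R, forall lam,
  lam0 <= lam -> forall n (v : 'cV[R]_n) b, dotp v v = 1 ->
  (\int[std_gauss R n]_e (rho lam b (dotp v e))%:E <= (lam ^+ 2 - 2 * lam - C)%:E)%E.
Proof.
move=> C0; have gap0 : 0 < gap by exact: dotp_le3_gap_gt0.
pose c := gap / 6; have c0 : 0 < c by rewrite divr_gt0.
pose K3 := (1 + ((1 + c) / c) ^+ 2) * K2.
have K30 : 0 <= K3 by rewrite mulr_ge0 ?(ltW K2_gt0)// addr_ge0// sqr_ge0.
exists (9 + K2 + C + K3 + 2 / gap * (2 + C + K2)) => lam lamge n v b v1.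
have gap1 := gap_le1 v1.
have gK : 0 <= 2 / gap * (2 + C + K2).
  by rewrite mulr_ge0 ?divr_ge0 ?(ltW gap0)// !addr_ge0 ?(ltW K2_gt0).
have lam9 : 9 + K2 + C <= lam by lra.
have lamK3 : 2 + K3 + C <= lam by move: K2_gt0; lra.
have lamgap : 2 / gap * (2 + C + K2) <= lam by move: K2_gt0; lra.
have lam1 : 9 <= lam by move: K2_gt0; lra.
(* The sign of the noise is reversed by replacing v with -v, again a unit vector. *)
wlog b0 : b v v1 / 0 <= b => [hw|].
  have [/hw|b0] := leP 0 b; first exact.
  have := hw (- b) (- v); rewrite dotpNl dotpNr opprK oppr_ge0 => /(_ v1 (ltW b0)).
  by under eq_integral do rewrite dotpNl rhoN.
(* Losing such a signal costs at most (lam - 3)^2, and 6 lam beats 2 lam. *)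
have [b3|b3] := leP b (lam - 3).
  apply: (le_trans (@integral_rho_le_sqr n v lam b 1 (b ^+ 2) predT v1 _ _ _ _)) => //.
  - by rewrite sqr_ge0.
  - by move=> w /=; rewrite mul1r mulr1 /rho; case: ifP => _; rewrite ?lerDl ?lerDr sqr_ge0.
  rewrite mul1r integral_cst_prob -EFinM -EFinD lee_fin mulr1.
  have : b ^+ 2 <= (lam - 3) ^+ 2 by rewrite ler_sqr ?nnegrE//; lra.
  by move: K2_gt0; nra.
(* As b > lam - 3, losing the signal forces w <= 3, of probability at most 1 - gap. With c = gap /
   6, b^2 <= (1 + gap/2) lam^2, and (1 + gap/2)(1 - gap) <= 1 - gap/2. *)
have [bc|bc] := leP b ((1 + c) * lam).
  apply: (le_trans (@integral_rho_le_sqr n v lam b 1 (b ^+ 2) (fun w => w <= 3)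
    v1 _ _ _ _)) => //.
  - by rewrite sqr_ge0.
  - by apply: measurable_fun_ler => //; exact: measurable_dotp.
  - move=> w; rewrite /rho; case: ltP => h.
      by rewrite mul1r lerDl mulr_ge0// sqr_ge0.
    have -> : w <= 3 by move: h; rewrite ler_norml => /andP[_]; lra.
    by rewrite mul1r mulr1 lerDr sqr_ge0.
  apply: (@le_trans _ _ ((1 * K2)%:E + (b ^+ 2)%:E * (1 - gap)%:E)%E).
    rewrite leeD2l// lee_wpmul2l// ?lee_fin ?sqr_ge0//; exact: integral_dotp_le3.
  rewrite -EFinM -EFinD lee_fin mul1r.
  have b2 : b ^+ 2 <= (1 + gap / 2) * lam ^+ 2.
    apply: (@le_trans _ _ (((1 + c) * lam) ^+ 2)).
      by rewrite ler_sqr ?nnegrE// mulr_ge0//; lra.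
    rewrite exprMn ler_wpM2r ?sqr_ge0// /c; nra.
  have b2g : b ^+ 2 * (1 - gap) <= (1 - gap / 2) * lam ^+ 2.
    apply: (@le_trans _ _ ((1 + gap / 2) * lam ^+ 2 * (1 - gap))).
      by rewrite ler_wpM2r//; lra.
    by rewrite mulrAC ler_wpM2r ?sqr_ge0//; nra.
  have : (2 + C + K2) * lam <= gap / 2 * lam ^+ 2.
    rewrite expr2 mulrA ler_wpM2r//; first by lra.
    move: lamgap; rewrite mulrAC ler_pdivrMr//; lra.
  move: K2_gt0; nra.
(* For larger b, losing the signal requires |w| >= b - lam >= c b / (1 + c), so b^2 is at most a
   constant times w^2 and the risk is bounded. *)
apply: (le_trans (@integral_rho_le_sqr n v lam b (1 + ((1 + c) / c) ^+ 2) 0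
  predT v1 _ _ _ _)) => //.
- by rewrite addr_ge0// sqr_ge0.
- move=> w; rewrite mul0r addr0 mulrDl mul1r /rho; case: ltP => h.
    by rewrite lerDl mulr_ge0// sqr_ge0.
  apply: (@le_trans _ _ (((1 + c) / c) ^+ 2 * w ^+ 2)); last by rewrite lerDr sqr_ge0.
  rewrite -exprMn -[leRHS]real_normK ?num_real// ler_sqr ?nnegrE//.
  rewrite normrM ger0_norm ?divr_ge0//; try lra.
  rewrite mulrAC ler_pdivlMr//.
  have : b - lam <= `|w|.
    have := ler_norm (- w); rewrite normrN.
    by move: h; rewrite ler_norml => /andP[_]; lra.
  nra.
rewrite mul0e adde0 lee_fin -/K3; exact: le_minus_linear.
Qed.

Lemma integral_rho0_le n (v : 'cV[R]_n) (lam : R) : dotp v v = 1 -> 0 <= lam ->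
  (\int[std_gauss R n]_e (rho lam 0 (dotp v e))%:E <=
   (8 * expR ((lam + 1) ^+ 2 / 2 - lam ^+ 2))%:E)%E.
Proof.
move=> v1 lam0; have := integral_sqr_tail_dotp v1 lam0; apply: le_trans.
rewrite le_eqVlt; apply/orP; left; apply/eqP.
by apply: eq_integral => e _; rewrite /rho add0r expr0n.
Qed.

End thresholding_risk.

(** * Hard thresholding under an orthogonal design *)

Section hard_threshold.
Context {R : realType} {n p : nat}.
Variable lam : R.

Definition score (z : 'M[R]_(n, p) * 'cV[R]_n) (j : 'I_p) : R :=
  (\sum_i z.1 i j * z.2 i 0) / n%:R.

Definition hard_threshold (z : 'M[R]_(n, p) * 'cV[R]_n) : 'cV[R]_p :=
  \col_j (if lam / Num.sqrt n%:R < `|score z j| then score z j else 0).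

Lemma measurable_hard_threshold : measurable_fun setT hard_threshold.
Proof.
apply/measurable_fun_entryP => j k.
have ms : measurable_fun setT (fun z => score z j).
  apply: measurable_funM => //; apply: measurable_sum => i; apply: measurable_funM.
    exact: (measurableT_comp (measurable_entry i j) measurable_fst).
  exact: (measurableT_comp (measurable_entry i 0) measurable_snd).
apply: (eq_measurable_fun (fun z =>
    if lam / Num.sqrt n%:R < `|score z j| then score z j else 0)) => [z _|].
  by rewrite mxE.
apply: measurable_fun_ifT => //; apply: measurable_fun_ltr => //.
exact: measurableT_comp.
Qed.

HB.instance Definition _ :=
  isMeasurableFun.Build _ _ _ _ hard_threshold measurable_hard_threshold.

Definition hard_thresholding : @estimator R n p := hard_threshold.

Variable X : 'M[R]_(n, p).
Hypothesis n0 : (0 < n)%N.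
Hypothesis orthX : orthogonal_design X.
Variable beta : 'cV[R]_p.

Let rn : R := Num.sqrt n%:R.
Let rn0 : 0 < rn. Proof. by rewrite sqrtr_gt0 ltr0n. Qed.
Let rn2 : rn ^+ 2 = n%:R. Proof. by rewrite sqr_sqrtr. Qed.
Let v (j : 'I_p) : 'cV[R]_n := rn^-1 *: col j X.

Let v1 j : dotp (v j) (v j) = 1.
Proof.
rewrite dotpZl dotpZr mulrA dotp_enorm (orthX.2 j) -/rn -expr2 -exprMn.
by rewrite mulVf ?gt_eqF// expr1n.
Qed.

(** Orthogonality removes the other coefficients: after scaling by sqrt n, coordinate j is a
    one-dimensional problem with signal sqrt n beta_j and noise along the unit vector x_j / sqrt
    n. *)
Lemma scoreE e j : score (X, X *m beta + e) j = (rn * beta j 0 + dotp (v j) e) / rn.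
Proof.
have -> : score (X, X *m beta + e) j = dotp (col j X) (X *m beta + e) / n%:R.
  by rewrite /score /dotp; congr (_ / _); apply: eq_bigr => i _; rewrite [col j X _ _]mxE.
have dX : dotp (col j X) (X *m beta) = n%:R * beta j 0.
  transitivity (((col j X)^T *m (X *m beta)) 0 0).
    by rewrite [RHS]mxE; apply: eq_bigr => i _; rewrite [in RHS]mxE.
  rewrite mulmxA mxE (bigD1 j)//= big1 ?addr0 => [|k kj].
    have -> : n%:R = dotp (col j X) (col j X) by rewrite dotp_enorm (orthX.2 j) rn2.
    congr (_ * _); rewrite mxE.
    by apply: eq_bigr => i _; rewrite !mxE.
  have jk : j != k by rewrite eq_sym.
  have /matrixP/(_ 0 0) := orthX.1 j k jk; rewrite [RHS]mxE => h.
  suff -> : ((col j X)^T *m X) 0 k = 0 by rewrite mul0r.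
  by rewrite -[RHS]h mxE [RHS]mxE; apply: eq_bigr => i _; rewrite !mxE.
rewrite dotpDr dX dotpZl -rn2; field.
by rewrite gt_eqF.
Qed.

Lemma score_gt e j :
  (lam / rn < `|score (X, X *m beta + e) j|) = (lam < `|rn * beta j 0 + dotp (v j) e|).
Proof.
by rewrite scoreE normrM (gtr0_norm (_ : 0 < rn^-1)) ?invr_gt0// ltr_pM2r ?invr_gt0.
Qed.

Lemma sqr_error_hard_threshold e :
  enorm (beta - hard_thresholding (X, X *m beta + e)) ^+ 2 =
  \sum_(j < p) n%:R^-1 * rho lam (rn * beta j 0) (dotp (v j) e).
Proof.
rewrite enorm_sqr; apply: eq_bigr => j _; rewrite !mxE /rho -score_gt -/rn.
case: ifP => _; last by rewrite subr0 exprMn rn2 mulrA mulVf ?mul1r// pnatr_eq0 -lt0n.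
by rewrite scoreE -rn2; field; rewrite gt_eqF.
Qed.

Local Open Scope ereal_scope.

Lemma Ebeta_sqr_error_hard_threshold (R1 R0 : R) : (0 <= R1)%R -> (0 <= R0)%R ->
  (forall b u, dotp u u = 1%R :> R ->
    \int[std_gauss R n]_e (rho lam b (dotp u e))%:E <= R1%:E) ->
  (forall u, dotp u u = 1%R :> R ->
    \int[std_gauss R n]_e (rho lam 0 (dotp u e))%:E <= R0%:E) ->
  Ebeta beta (fun z => enorm (beta - hard_thresholding z) ^+ 2)%R X <=
  (((l0norm beta)%:R * R1 + p%:R * R0) / n%:R)%:E.
Proof.
move=> R10 R00 hR1 hR0; rewrite /Ebeta.
under eq_integral do rewrite sqr_error_hard_threshold -sumEFin.
have ni0 : (0 <= n%:R^-1 :> R)%R by rewrite invr_ge0.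
rewrite ge0_integral_sum//; last 2 first.
- move=> j; apply/measurable_EFinP; apply: measurable_funM => //.
  exact: measurable_rho.
- by move=> j e _; rewrite lee_fin mulr_ge0// rho_ge0.
apply: (@le_trans _ _ (\sum_(j < p)
    (n%:R^-1 * (if beta j 0%R != 0%R then R1 else R0))%:E)).
  apply: lee_sum => j _.
  under eq_integral do rewrite EFinM.
  rewrite ge0_integralZl_EFin//; last 2 first.
  - by move=> e _; rewrite lee_fin rho_ge0.
  - by apply/measurable_EFinP; exact: measurable_rho.
  rewrite EFinM lee_wpmul2l// ?lee_fin//.
  by case: eqP => [->|_] /=; [rewrite mulr0; exact: hR0|exact: hR1].
rewrite sumEFin lee_fin -mulr_sumr mulrC ler_wpM2r//.
rewrite (bigID (fun j => beta j 0%R != 0%R))/= lerD//.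
  rewrite (eq_bigr (fun=> R1)) => [|j ->//].
  rewrite sumr_const /l0norm -[leLHS]mulr_natl ler_wpM2r// ler_nat.
  by rewrite cardsE.
rewrite (eq_bigr (fun=> R0)) => [|j /negbTE ->//].
rewrite sumr_const -[leLHS]mulr_natl ler_wpM2r// ler_nat.
by rewrite -[leqRHS]card_ord max_card.
Qed.

Lemma Ebeta_FP_hard_threshold : (0 <= lam)%R ->
  Ebeta beta (fun z => (FP (hard_thresholding z) beta)%:R) X <=
  (p%:R * (2 * expR (- lam ^+ 2 / 2)))%:E.
Proof.
move=> lam0; rewrite /Ebeta.
have mind j : measurable_fun setT (fun e => ((lam < `|dotp (v j) e|)%R%:R : R)%:E).
  apply/measurable_EFinP; apply: measurable_natr_bool; apply: measurable_fun_ltr => //.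
  by apply: measurableT_comp => //; exact: measurable_dotp.
apply: (@le_trans _ _ (\int[std_gauss R n]_e
    \sum_(j < p) ((lam < `|dotp (v j) e|)%R%:R)%:E)).
  apply: ge0_le_integral => //.
  - apply/measurable_EFinP.
    exact: (measurable_section_model beta X (measurable_FP hard_thresholding beta)).
  - exact: emeasurable_sum.
  - move=> e _; rewrite sumEFin lee_fin FP_sumE big_mkcond/=.
    apply: ler_sum => j _; rewrite finset.in_setT mxE -/rn score_gt.
    have [->|] := eqVneq (beta j 0%R) 0%R; last by rewrite andbF.
    rewrite mulr0 add0r andbT ler_nat.
    by case: (lam < _)%R => /=; rewrite ?leq_b1 ?eqxx.
rewrite ge0_integral_sum//.
apply: (@le_trans _ _ (\sum_(j < p) (2 * expR (- lam ^+ 2 / 2))%:E)).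
  by apply: lee_sum => j _; exact: integral_tail_dotp.
by rewrite sumEFin sumr_const card_ord lee_fin -[leLHS]mulr_natl.
Qed.

End hard_threshold.

(** * Upper bounds on the minimax number of false positives *)

Section upper_bound.
Context {R : realType} {n p : nat}.
Variable mu : probability 'M[R]_(n, p) R.
Local Open Scope ereal_scope.

Lemma EXEbeta_ae_le (P : 'M[R]_(n, p) -> Prop) beta
    (f : 'M[R]_(n, p) * 'cV[R]_n -> R) (c : R) :
  (0 <= c)%R -> {ae mu, forall X, P X} ->
  measurable_fun setT f -> (forall z, 0 <= f z)%R ->
  (forall X, P X -> Ebeta beta f X <= c%:E) -> EXEbeta mu beta f <= c%:E.
Proof.
move=> c0 aeP mf f0 le; rewrite -[leRHS](integral_cst_prob mu).
apply: ae_ge0_le_integral => //.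
- by move=> X _; exact: Ebeta_ge0.
- exact: measurable_Ebeta.
- by apply: filterS aeP => X PX _; exact: le.
Qed.

(** This trivial count already has the order required in the dense case. *)
Lemma sup_FP_le_dim s (bh : @estimator R n p) : sup_FP s mu bh <= p%:R%:E.
Proof.
apply/ereal_supP => _ [beta _ <-]; rewrite -[leRHS](EXEbeta_cst mu beta).
apply: EXEbeta_le => //; first exact: measurable_FP.
by move=> z; rewrite ler0n ler_nat -[leqRHS]card_ord max_card.
Qed.

(** [R1] and [R0] bound the scaled risk of a signal and of a null coordinate; the last inequality,
    divided by n, is membership in Omega. *)
Lemma hard_threshold_minimax (s : nat) (c1 lam R1 R0 : R) :
  (0 < n)%N -> {ae mu, forall X, orthogonal_design X} ->
  (0 <= lam)%R -> (0 <= R1)%R -> (0 <= R0)%R ->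
  (forall b (u : 'cV[R]_n), dotp u u = 1%R ->
    \int[std_gauss R n]_e (rho lam b (dotp u e))%:E <= R1%:E) ->
  (forall u : 'cV[R]_n, dotp u u = 1%R ->
    \int[std_gauss R n]_e (rho lam 0 (dotp u e))%:E <= R0%:E) ->
  (s%:R * R1 + p%:R * R0 <= c1 * s%:R * ln (p%:R / s%:R))%R ->
  minimax_FP s mu c1 <= (p%:R * (2 * expR (- lam ^+ 2 / 2)))%:E.
Proof.
move=> n0 orth lam0 R10 R00 hR1 hR0 bound.
apply: (@le_trans _ _ (sup_FP s mu (hard_thresholding lam))).
  apply: ereal_inf_lbound; exists (hard_thresholding lam) => //.
  apply/ereal_supP => _ [beta sb <-].
  apply: (EXEbeta_ae_le _ orth); last 1 first.
  - move=> X oX.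
    apply: le_trans (Ebeta_sqr_error_hard_threshold n0 oX beta R10 R00 hR1 hR0) _.
    rewrite lee_fin ler_wpM2r ?invr_ge0//; apply: le_trans bound.
    by rewrite lerD2r ler_wpM2r// ler_nat.
  - rewrite mulr_ge0 ?invr_ge0//; apply: le_trans bound.
    by rewrite addr_ge0// mulr_ge0.
  - exact: measurable_sqr_error.
  - by move=> z; exact: sqr_ge0.
apply/ereal_supP => _ [beta sb <-].
apply: (EXEbeta_ae_le _ orth); last 1 first.
- by move=> X oX; exact: Ebeta_FP_hard_threshold.
- by rewrite mulr_ge0// mulr_ge0// expR_ge0.
- exact: measurable_FP.
- by move=> z; exact: ler0n.
Qed.

End upper_bound.

Section sparse_upper_bound.
Context {R : realType}.
Variables (p s : nat -> nat) (mu : forall n : nat, probability 'M[R]_(n, p n) R).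
Hypothesis Hsp : forall n : nat, (1 <= s n <= p n)%N.
Variable c1 : R.
Hypothesis c12 : 2 <= c1.

Local Notation x n := ((s n)%:R / (p n)%:R : R).
Local Notation L n := (ln ((p n)%:R / (s n)%:R) : R).

(* The threshold lam = sqrt (c1 L) + 1 makes the null coordinates cost O(s)
   while the signals cost at most lam^2 - 2 lam - C < c1 L - C each. *)
Lemma sparse_minimax_upper_bound :
  (\forall n \near \oo, {ae mu n, forall X, orthogonal_design X}) ->
  x n @[n --> \oo] --> (0 : R) -> \forall n \near \oo,
  (minimax_FP (s n) (mu n) c1 <= (2 * (p n)%:R * x n `^ (c1 / 2))%:E)%E.
Proof.
move=> orth x0; have c10 : 0 < c1 by exact: lt_le_trans c12.
pose C : R := 8 * expR 1.
have C0 : 0 <= C by rewrite mulr_ge0 ?expR_ge0.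
have [lam0 rho_le] := integral_rho_le C0.
pose A := `|lam0| + 2 + C.
have A0 : 0 <= A by rewrite !addr_ge0.
near=> n.
have n0 : (0 < n)%N by near: n; exact: nbhs_infty_gt.
have oX : {ae mu n, forall X, orthogonal_design X} by near: n.
have LA : A ^+ 2 / c1 <= L n.
  by apply: (log_ratio_ge Hsp); near: n; apply: (cvgr_le _ x0); exact: expR_gt0.
pose l := Num.sqrt (c1 * L n); pose lam := l + 1.
have cLA : A ^+ 2 <= c1 * L n by move: LA; rewrite ler_pdivrMr// mulrC.
have l2 : l ^+ 2 = c1 * L n by rewrite sqr_sqrtr// (le_trans _ cLA)// sqr_ge0.
have lA : A <= l.
  by rewrite -(ler_pXn2r (ltn0Sn 1)) ?nnegrE ?sqrtr_ge0// l2.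
have l0 : 0 <= l by exact: le_trans lA.
have lam0le : lam0 <= lam by have := ler_norm lam0; move: lA; rewrite /A /lam; lra.
have lamC : 2 + C <= lam by have := normr_ge0 lam0; move: lA; rewrite /A /lam; lra.
have powE : x n `^ (c1 / 2) = expR (- l ^+ 2 / 2).
  by rewrite (ratio_powRE Hsp) l2; congr expR; field.
have R10 : 0 <= lam ^+ 2 - 2 * lam - C.
  by apply: le_minus_linear => //; rewrite addr0.
(* With lam = l + 1 the exponent (l + 2)^2 / 2 - (l + 1)^2 equals 1 - l^2 / 2: the added 1 in the
   threshold cancels the exp(lam) loss of the tail bound, and C = 8 e. *)
have R0E : 8 * expR ((lam + 1) ^+ 2 / 2 - lam ^+ 2) = C * x n `^ (c1 / 2).
  by rewrite /C powE -mulrA -expRD; congr (_ * expR _); rewrite /lam; field.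
have lam_ge0 : 0 <= lam by rewrite addr_ge0.
apply: le_trans (@hard_threshold_minimax R n (p n) (mu n) (s n) c1 lam
  (lam ^+ 2 - 2 * lam - C) (C * x n `^ (c1 / 2)) n0 oX lam_ge0 R10 _ _ _ _) _.
- by rewrite mulr_ge0// powR_ge0.
- by move=> b u u1; exact: rho_le.
- by move=> u u1; rewrite -R0E; exact: integral_rho0_le.
(* The condition c1 >= 2 gives (s/p)^(c1/2) <= s/p, so the null coordinates cost at most C s in
   total. As lam^2 - 2 lam = l^2 - 1, this C s cancels the one saved on the signals. *)
- have xpow : (p n)%:R * x n `^ (c1 / 2) <= (s n)%:R.
    apply: (@le_trans _ _ ((p n)%:R * x n)).
      rewrite ler_wpM2l// -[leRHS]powRr1 ?(ltW (ratio_gt0 Hsp n))//.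
      apply: ger_powR; last by rewrite ler_pdivlMr// mul1r.
      rewrite (ratio_gt0 Hsp)/= ler_pdivrMr ?(p_gt0 Hsp)// mul1r ler_nat.
      by case/andP: (Hsp n).
    by rewrite mulrC divfK// gt_eqF ?(p_gt0 Hsp).
  rewrite [X in _ + X <= _]mulrCA [leRHS]mulrAC -l2.
  rewrite (_ : l = lam - 1); last by rewrite /lam addrK.
  apply: (@le_trans _ _ ((s n)%:R * (lam ^+ 2 - 2 * lam - C) + C * (s n)%:R)).
    by rewrite lerD2l ler_wpM2l.
  have := s_gt0 Hsp n (R := R); nra.
rewrite lee_fin mulrCA mulrA powE ler_wpM2l ?mulr_ge0// ler_expR.
rewrite /lam; nra.
Unshelve. all: by end_near. Qed.

End sparse_upper_bound.

Theorem corollary2p3 (R : realType) (p s : nat -> nat)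
  (mu : forall n : nat, probability 'M[R]_(n, p n) R)
  (zeta c1 : R)
  (Hsp : forall n : nat, (1 <= s n <= p n)%N)
  (Hp : p @ \oo --> \oo)
  (Hzeta : limn_esup (fun n : nat => ((s n)%:R / (p n)%:R : R)%:E) = zeta%:E)
  (Hzeta01 : 0 <= zeta < 1)
  (Hdesign : forall c3 : R, 0 < c3 ->
     \big[Order.min/1%E]_(i < p n)
       mu n [set X | `|enorm (col i X) ^+ 2 / n%:R - 1| <= c3]
     @[n --> \oo] --> 1%E)
  (Hc1 : 0 < c1) :
  (exists2 C : R, 0 < C &
     ((s n)%:R / (p n)%:R @[n --> \oo] --> zeta -> 0 < zeta ->
        \forall n \near \oo,
          ((C * (p n)%:R)%:E <= minimax_FP (s n) (mu n) c1)%E)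
     /\
     ((s n)%:R / (p n)%:R @[n --> \oo] --> (0 : R) ->
        exists2 delta : nat -> R, delta @ \oo --> (0 : R) &
        \forall n \near \oo,
          ((C * (p n)%:R * ((s n)%:R / (p n)%:R) `^ (c1 / 2 + delta n))%:E
           <= minimax_FP (s n) (mu n) c1)%E))
  /\
  ((\forall n \near \oo, {ae mu n, forall X, orthogonal_design X}) ->
   (\forall n \near \oo, Omega (s n) (mu n) c1 !=set0) ->
   exists2 C' : R, 0 < C' &
     ((s n)%:R / (p n)%:R @[n --> \oo] --> zeta -> 0 < zeta ->
        \forall n \near \oo,
          (minimax_FP (s n) (mu n) c1 <= (C' * (p n)%:R)%:E)%E)
     /\
     ((s n)%:R / (p n)%:R @[n --> \oo] --> (0 : R) ->
      (1 <= limn_einf (fun n : nat =>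
              (c1 * (s n)%:R * ln ((p n)%:R / (s n)%:R))%:E
              / (n%:R%:E * r_opt (s n) (mu n))))%E ->
        exists2 delta' : nat -> R, delta' @ \oo --> (0 : R) &
        \forall n \near \oo,
          (minimax_FP (s n) (mu n) c1 <=
           (C' * (p n)%:R * ((s n)%:R / (p n)%:R) `^ (c1 / 2 + delta' n))%:E)%E)).
Proof.
split.
  have [C C0 dense] : exists2 C : R, 0 < C &
      ((s n)%:R / (p n)%:R @[n --> \oo] --> zeta -> 0 < zeta ->
       \forall n \near \oo, ((C * (p n)%:R)%:E <= minimax_FP (s n) (mu n) c1)%E).
    (* One constant must serve both cases: the dense case dictates it when it occurs, and the sparse
       bound accepts any positive C. *)
    have [[xz z0]|nxz] := pselect
        ((s n)%:R / (p n)%:R @[n --> \oo] --> zeta /\ 0 < zeta).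
      have z01 : 0 < zeta < 1 by rewrite z0; case/andP: Hzeta01.
      by have [C C0 lb] := dense_lower_bound Hsp Hdesign Hc1 z01 xz; exists C.
    by exists 1 => // xz z0; case: nxz.
  exists C => //; split=> // x0.
  exact: sparse_minimax_lower_bound.
move=> orth ne; exists 2 => //; split=> [_ _|x0 _].
  (* A member of Omega keeps the infimum from being +oo. *)
  near=> n; have [bh bhO] : Omega (s n) (mu n) c1 !=set0 by near: n.
  apply: (@le_trans _ _ (sup_FP (s n) (mu n) bh)).
    by apply: ereal_inf_lbound; exists bh.
  apply: le_trans (sup_FP_le_dim _ _ _) _.
  by rewrite lee_fin ler_peMl// ler1n.
exists (fun=> 0); first exact: cvg_cst.
have [c12|c12] := leP 2 c1.
  have := sparse_minimax_upper_bound Hsp c12 orth x0.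
  by apply: filterS => n; rewrite addr0.
(* For c1 < 2 the assumed nonemptiness of Omega is eventually contradicted. *)
have em := near_Omega_empty Hsp Hdesign Hc1 c12 x0.
near=> n; exfalso.
have : ~ (Omega (s n) (mu n) c1 !=set0) by near: n.
by apply; near: n.
Unshelve. all: by end_near. Qed.
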